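(* Let $A$ be a finitely presented connected graded algebra over a field $k$, and let $\mathbf{F}$ be a quasi-coherent family of ideals of degree $d$ in $A$. Then the set of Hilbert series of ideals $I\in\mathbf{F}$ is finite.
   Context: A connected graded algebra over $k$ is an associative algebra $A=\bigoplus_{i\ge 0}A_i$ with $A_0=k$; it is finitely presented if it has finitely many generators and finitely many relations. For a graded right module $M$, $m_0(M)$ is the supremum of the degrees of minimal homogeneous generators of $M$, i.e. $m_0(M)=\sup\{j\mid \mathrm{Tor}_0^A(M,k)_j\ne0\}$ (and $0$ if $M=0$). $[-t]$ denotes the degree shift $(V[-t])_j=V_{j-t}$. A set $\mathbf{F}$ of finitely generated homogeneous right ideals of $A$ is a quasi-coherent family of ideals if $0\in\mathbf{F}$ and for every $0\ne I\in\mathbf{F}$ there are $J_1,J_2\in\mathbf{F}$ such that $J_1\subset I$, $J_1\ne I$, $m_0(J_1)\le m_0(I)$, and $I/J_1\cong (A/J_2)[-t]$ as graded right modules for some integer $t\ge0$. It is of degree $d$ if $m_0(I)\le d$ for all $I\in\mathbf{F}$. The Hilbert series of a locally finite graded vector space $V$ is $V(z)=\sum_i(\dim_k V_i)z^i$. *)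

(* Defs.v *)
From HB Require Import structures.
From mathcomp Require Import all_boot all_order all_algebra.
From mathcomp Require Import boolp classical_sets cardinality.
From mathcomp.multinomials Require Import monalg.

Set Implicit Arguments.
Unset Strict Implicit.
Unset Printing Implicit Defensive.

Import GRing.Theory.

Local Open Scope quotient_scope.
Local Open Scope classical_set_scope.
Local Open Scope ring_scope.

Section QuotientModule.
Variables (R : pzRingType) (V : lmodType R) (W : submodClosed V).

(* A submodClosed predicate does not canonically have the zmodClosed          *)
(* structure that Quotient.quot requires.                                     *)
Definition submod_zmod : {pred V} := W.

Fact submod_zmod_closed : zmod_closed submod_zmod.
Proof. exact: GRing.submod_closedB (submodClosedP W). Qed.

HB.instance Definition _ := GRing.isZmodClosed.Build V submod_zmod
  submod_zmod_closed.

Definition quotmod : Type := Quotient.quot submod_zmod.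

HB.instance Definition _ := GRing.Zmodule.on quotmod.
HB.instance Definition _ := Quotient.on quotmod.

Definition quotmod_scale (a : R) := lift_op1 quotmod ( *:%R a).

Lemma quotmod_eq (x y : V) :
  (\pi_quotmod x = \pi_quotmod y) <-> (x - y \in W).
Proof.
rewrite -[x - y \in W]/(x - y \in submod_zmod) Quotient.idealrBE.
by split=> [xy|/eqP //]; apply/eqP.
Qed.

Lemma quotmod_piD : {morph \pi_quotmod : x y / x + y}.
Proof. by move=> x y; rewrite /quotmod !piE. Qed.

Lemma quotmod_piZ (a : R) (x : V) :
  quotmod_scale a (\pi_quotmod x) = \pi_quotmod (a *: x).
Proof.
unlock quotmod_scale; apply/quotmod_eq; rewrite -scalerBr rpredZ //.
by apply/quotmod_eq; rewrite reprK.
Qed.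

Fact quotmod_scaleA a b (x : quotmod) :
  quotmod_scale a (quotmod_scale b x) = quotmod_scale (a * b) x.
Proof. by elim/quotW: x => x; rewrite !quotmod_piZ scalerA. Qed.

Fact quotmod_scale1 : left_id 1 quotmod_scale.
Proof. by elim/quotW=> x; rewrite quotmod_piZ scale1r. Qed.

Fact quotmod_scaleDr : right_distributive quotmod_scale +%R.
Proof.
move=> a; elim/quotW=> x; elim/quotW=> y.
by rewrite -quotmod_piD !quotmod_piZ -quotmod_piD scalerDr.
Qed.

Fact quotmod_scaleDl (x : quotmod) :
  {morph quotmod_scale^~ x : a b / a + b}.
Proof.
by elim/quotW: x => x a b; rewrite !quotmod_piZ -quotmod_piD scalerDl.
Qed.

HB.instance Definition _ := GRing.Zmodule_isLmodule.Build R quotmod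
  quotmod_scaleA quotmod_scale1 quotmod_scaleDr quotmod_scaleDl.

Definition quotmod_pi (x : V) : quotmod := \pi_quotmod x.

Fact quotmod_pi_is_linear : linear quotmod_pi.
Proof. by move=> a x y; rewrite /quotmod_pi quotmod_piD -quotmod_piZ. Qed.

HB.instance Definition _ :=
  GRing.isLinear.Build R V quotmod *:%R quotmod_pi quotmod_pi_is_linear.

End QuotientModule.

Section GeneratedSubmodule.
Variables (R : pzRingType) (V : lmodType R) (S : set V).

Definition gen_submod : {pred V} := fun x =>
  `[< forall W : submodClosed V, (forall y, S y -> y \in W) -> x \in W >].

Fact gen_submod_closed : submod_closed gen_submod.
Proof.
split; first by apply/asboolP => W _; rewrite rpred0.
move=> a x y /asboolP Sx /asboolP Sy; apply/asboolP => W SW.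
by rewrite rpredD ?rpredZ ?Sx ?Sy.
Qed.

HB.instance Definition _ := GRing.isSubmodClosed.Build R V gen_submod
  gen_submod_closed.

End GeneratedSubmodule.
Section Dimension.
Variables (k : fieldType) (V : lmodType k).

Definition is_basis (U : set V) (n : nat) (e : 'I_n -> V) : Prop :=
  (forall i, U (e i)) /\
  forall u, U u -> exists! c : {ffun 'I_n -> k}, u = \sum_i c i *: e i.

(* The value on infinite-dimensional subspaces is the dummy 0.                *)
Definition subspace_dim (U : set V) : nat :=
  xget 0%N [set n | exists e : 'I_n -> V, is_basis U e].

(* The sum of the subsets S_ i, made of the finite sums with terms in them.   *)
Definition sum_sets (S_ : nat -> set V) : set V :=
  [set x | exists n, exists c : nat -> V,
     (forall i, S_ i (c i)) /\ x = \sum_(i < n) c i].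

End Dimension.

Section FinitePresentation.

Definition two_sided_ideal_gen (R : pzRingType) (r : seq R) : set R :=
  [set g | exists s : seq (R * R * R),
     (forall t, t \in s -> t.1.2 \in r) /\
     g = \sum_(t <- s) t.1.1 * t.1.2 * t.2].

(* {malg k[{fmonom 'I_n}]} is the free associative algebra k<X_1, ..., X_n>.  *)
Definition finitely_presented (k : fieldType) (A : algType k) : Prop :=
  exists (n : nat) (phi : {lrmorphism {malg k[{fmonom 'I_n}]} -> A})
         (r : seq {malg k[{fmonom 'I_n}]}),
    (forall a, exists g, phi g = a) /\
    [set g | phi g = 0] = two_sided_ideal_gen r.

End FinitePresentation.

(* Right A-modules are left modules over the opposite ring A^c, and right     *)
(* ideals of A are the submodules of the right regular module: in (A^c)^o,    *)
(* a *: x is the product x * a of A.                                          *)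
Notation right_ideal A := (submodClosed (A^c)^o).

Lemma right_idealM (k : fieldType) (A : algType k) (I : right_ideal A)
    (x a : A) :
  x \in I -> x * a \in I.
Proof. exact: (rpredZ (a : A^c)). Qed.

Section GradedAlgebra.
Variables (k : fieldType) (A : algType k).

Record connected_graded (A_ : nat -> submodClosed A) : Prop :=
  ConnectedGraded {
    grade_span : forall a : A, sum_sets (fun i => [set x | x \in A_ i]) a;
    grade_indep : forall n (c : nat -> A), (forall i, c i \in A_ i) ->
      \sum_(i < n) c i = 0 -> forall i, (i < n)%N -> c i = 0;
    grade_mul : forall i j (x y : A),
      x \in A_ i -> y \in A_ j -> x * y \in A_ (i + j)%N;
    grade_connected : forall x : A, x \in A_ 0%N <-> exists c : k, x = c%:A }.

Variable A_ : nat -> submodClosed A.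

Implicit Types I J : right_ideal A.

Definition component (I : {pred A}) (j : nat) : set A :=
  [set x | x \in I /\ x \in A_ j].

Definition homogeneous I : Prop :=
  forall x : A, x \in I -> sum_sets (component I) x.

Definition finitely_generated I : Prop :=
  exists s : seq A, I =i gen_submod (V := (A^c)^o) [set x | x \in s].

(* The coefficient sequence of the series sum_j (dim I_j) z^j.                *)
Definition hilbert_series I : nat -> nat :=
  fun j => subspace_dim (component I j).

(* The degree j component of I / J, for a right ideal J contained in I, seen  *)
(* inside A / J.                                                              *)
Definition quot_component (I : {pred A}) J (j : nat) : set (quotmod J) :=
  quotmod_pi J @` component I j.
Arguments quot_component : clear implicits.

(* ((A / J)[-t])_j = (A / J)_(j - t), which is 0 when j < t.                  *)
Definition shift_quot_component J (t j : nat) : set (quotmod J) :=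
  if (t <= j)%N then quot_component predT J (j - t) else [set 0].
Arguments shift_quot_component : clear implicits.

(* I / J1 and (A / J2)[-t] are isomorphic graded right A-modules; I / J1 is   *)
(* the image of I in A / J1.                                                  *)
Definition shift_isomorphic I J1 J2 (t : nat) : Prop :=
  exists f : {linear quotmod J2 -> quotmod J1},
    [/\ injective f,
        range f = quotmod_pi J1 @` [set x | x \in I] &
        forall j,
          f @` shift_quot_component J2 t j = quot_component I J1 j].

(* I A_+, where A_+ is the sum of the A_ j with j > 0.                        *)
Definition aug_mul I : right_ideal A :=
  gen_submod (V := (A^c)^o)
    [set y : A | exists (x a : A) (j : nat),
       [/\ x \in I, a \in A_ j, (0 < j)%N & y = x * a]].

(* Tor_0^A(I, k)_j, computed as the degree j component of I / I A_+, which is *)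
(* I tensored over A with k = A / A_+.                                        *)
Definition tor0 I (j : nat) : set (quotmod (aug_mul I)) :=
  quot_component I (aug_mul I) j.
Arguments tor0 : clear implicits.

(* The supremum of the empty set is 0 here; the set of degrees is bounded     *)
(* when I is finitely generated.                                              *)
Definition m0 I : nat := supremum 0%N [set j : nat | tor0 I j <> [set 0]].

Record quasi_coherent_family (F : set (right_ideal A)) : Prop :=
  QuasiCoherentFamily {
    qc_ideals : forall I, F I -> finitely_generated I /\ homogeneous I;
    qc_zero : exists2 Z, F Z & Z =i pred1 0;
    qc_step : forall I, F I -> (exists2 x, x \in I & x != 0) ->
      exists J1 J2, F J1 /\ F J2 /\
        [/\ {subset J1 <= I}, ~ {subset I <= J1}, (m0 J1 <= m0 I)%N &
            exists t : nat, shift_isomorphic I J1 J2 t] }.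

Definition of_degree (F : set (right_ideal A)) (d : nat) : Prop :=
  forall I, F I -> (m0 I <= d)%N.

End GradedAlgebra.

Arguments quot_component {k A} A_ I J j _.
Arguments shift_quot_component {k A} A_ J t j _.
Arguments tor0 {k A} A_ I j _.

(* Main.v *)
(* Climbing the chain I > J1 > ... down to 0 gives generators of I in degrees *)
(* at most d, boundedly many of them. The relations among these generators    *)
(* come from the generators of the ideals J2 met on the way, so they are      *)
(* generated in degrees at most 2d. Fix the degrees of the generators and the *)
(* dimensions of the components of I in degrees at most 2d. Then each dim I_n *)
(* is locally constant, for the Zariski topology on the tuples x of           *)
(* generators: it is the rank of a matrix depending polynomially on x, hence  *)
(* lower semicontinuous, and the kernel of this matrix is spanned by products *)
(* with the kernels in degrees at most 2d, which vary polynomially because    *)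
(* their dimensions are fixed, so that it too has lower semicontinuous        *)
(* dimension. By Hilbert's basis theorem the space of tuples is Noetherian,   *)
(* so a sequence of locally constant functions on it takes finitely many      *)
(* values.                                                                    *)
From HB Require Import structures.
Require Import Defs.
From mathcomp Require Import all_boot all_order all_algebra.
From mathcomp Require Import boolp classical_sets cardinality.
From mathcomp.multinomials Require Import monalg.

Set Implicit Arguments.
Unset Strict Implicit.
Unset Printing Implicit Defensive.

Import GRing.Theory.

Local Open Scope classical_set_scope.
Local Open Scope ring_scope.

(** * Noetherian rings *)

(** A presentation of [I] consists of homogeneous generators x_i of degrees t_i <= d together with
    the fact that all their relations are generated in degrees at most 2d. [presentation_exists]
    produces one for each ideal of the family: a step I > J1 adds one generator of degree at most d
    ([family_step]), its new relations come from generators of J2 ([presentation_step]), and the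
    total dimension in degrees at most d drops, which bounds the number of steps independently of
    [I]. For given degrees t_i, the dimension of I_n is the rank of the degree n part of a |-> sum
    x_i a_i, a matrix linear in the coordinates of x ([presentation_hilbert_series]). Above degree
    2d its kernel is spanned by multiples of the kernels in degrees at most 2d
    ([presentation_kernel]). Once the ranks in degrees at most 2d are prescribed, rank and nullity
    are both lower semicontinuous in x, so the rank is locally constant ([rank_locally_constant]),
    and [finite_locally_constant] leaves finitely many Hilbert series. There are finitely many
    choices of degrees and of low ranks. Noetherianity is used in this form: every sequence has a
    term in the ideal generated by the earlier ones. *)

Definition noetherian (R : comNzRingType) : Prop :=
  forall f : nat -> R, exists m (c : nat -> R), f m = \sum_(i < m) c i * f i.

Lemma field_noetherian (k : fieldType) : noetherian k.
Proof.
move=> f; have [f0|f0] := eqVneq (f 0%N) 0.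
  by exists 0%N, f; rewrite big_ord0.
by exists 1%N, (fun _ => f 1%N / f 0%N); rewrite big_ord1 divfK.
Qed.

Section HilbertBasis.
Variable R : comNzRingType.

Definition ideal_of (s : seq R) (x : R) : Prop :=
  exists c : nat -> R, x = \sum_(i < size s) c i * s`_i.

Lemma ideal_of0 s : ideal_of s 0.
Proof. by exists (fun _ => 0); rewrite big1 // => i _; rewrite mul0r. Qed.

Lemma ideal_ofD s x y : ideal_of s x -> ideal_of s y -> ideal_of s (x + y).
Proof.
move=> [c ->] [c' ->]; exists (fun i => c i + c' i).
by rewrite -big_split; apply: eq_bigr => i _; rewrite mulrDl.
Qed.

Lemma ideal_ofM s a x : ideal_of s x -> ideal_of s (a * x).
Proof.
move=> [c ->]; exists (fun i => a * c i).
by rewrite mulr_sumr; apply: eq_bigr => i _; rewrite mulrA.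
Qed.

Lemma ideal_of_mem (s : seq R) x : x \in s -> ideal_of s x.
Proof.
move=> xs; exists (fun i => (i == index x s)%:R).
have lt_xs : (index x s < size s)%N by rewrite index_mem.
rewrite (bigD1 (Ordinal lt_xs)) //= eqxx mul1r nth_index // big1 ?addr0 //.
by move=> i ne; rewrite -[_ == _]/(i == Ordinal lt_xs) (negPf ne) mul0r.
Qed.

Lemma ideal_of_sum s m (F : nat -> R) :
  (forall i, (i < m)%N -> ideal_of s (F i)) -> ideal_of s (\sum_(i < m) F i).
Proof.
elim: m => [|m IHm] sF; first by rewrite big_ord0; apply: ideal_of0.
rewrite big_ord_recr; apply: ideal_ofD; last exact: sF.
by apply: IHm => i lt_im; apply: sF; apply: ltnW.
Qed.

Lemma ideal_of_trans (s s' : seq R) x :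
  (forall y, y \in s -> ideal_of s' y) -> ideal_of s x -> ideal_of s' x.
Proof.
move=> ss' [c ->]; apply: (@ideal_of_sum s' _ (fun i => c i * s`_i)) => i lt_is.
by apply/ideal_ofM/ss'/mem_nth.
Qed.

Lemma ideal_of_sub (s s' : seq R) x :
  {subset s <= s'} -> ideal_of s x -> ideal_of s' x.
Proof. by move=> ss'; apply: ideal_of_trans => y /ss'; apply: ideal_of_mem. Qed.

Lemma noetherianP :
  noetherian R <-> forall f : nat -> R, exists m, ideal_of (mkseq f m) (f m).
Proof.
split=> Rn f.
  have [m [c fm]] := Rn f; exists m, c; rewrite size_mkseq fm.
  by apply: eq_bigr => i _; rewrite nth_mkseq.
have [m [c]] := Rn f; rewrite size_mkseq => fm; exists m, c; rewrite fm.
by apply: eq_bigr => i _; rewrite nth_mkseq.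
Qed.

End HilbertBasis.

(* History-dependent choice: pick gets the list of the values chosen so far.  *)
Fixpoint greedy_hist (T : Type) (pick : seq T -> T) (n : nat) : seq T :=
  if n is n'.+1 then
    let s := greedy_hist pick n' in rcons s (pick s)
  else [::].

Definition greedy (T : Type) (pick : seq T -> T) (n : nat) : T :=
  pick (greedy_hist pick n).

Lemma greedy_histE (T : Type) (pick : seq T -> T) n :
  greedy_hist pick n = mkseq (greedy pick) n.
Proof.
elim: n => // n IHn; rewrite mkseqS -IHn.
by rewrite /greedy.
Qed.

Lemma greedyE (T : Type) (pick : seq T -> T) n :
  greedy pick n = pick (mkseq (greedy pick) n).
Proof. by rewrite {1}/greedy greedy_histE. Qed.

(** Hilbert's argument. If the ideal [I] generated by the sequence [F] were not finitely generated,
    choose g_n in [I] of least degree outside the ideal of g_0, ..., g_(n-1). Some leading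
    coefficient is a combination of the earlier ones, and cancelling the leading term of that g_m
    contradicts its minimality. *)
Lemma poly_noetherian (R : comNzRingType) :
  noetherian R -> noetherian {poly R}.
Proof.
move=> Rn; apply/noetherianP => F; apply: contrapT => /forallNP badF.
pose I p := exists N, ideal_of (mkseq F N) p.
have I_mono N N' p : (N <= N')%N ->
    ideal_of (mkseq F N) p -> ideal_of (mkseq F N') p.
  move=> le_NN'; apply: ideal_of_sub => q /mapP[i]; rewrite mem_iota => iN ->.
  by apply/map_f; rewrite mem_iota (leq_trans _ le_NN').
have ID p q : I p -> I q -> I (p + q).
  move=> [N pN] [N' qN']; exists (maxn N N').
  by apply: ideal_ofD; [apply: I_mono pN | apply: I_mono qN'];
     rewrite ?leq_maxl ?leq_maxr.
have IM p q : I q -> I (p * q) by move=> [N qN]; exists N; apply: ideal_ofM.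
have fresh s : (forall p, p \in s -> I p) -> exists p, I p /\ ~ ideal_of s p.
  move=> sI.
  have [N sN] : exists N, forall p, p \in s -> ideal_of (mkseq F N) p.
    elim: s sI => [|p s IHs] sI; first by exists 0%N.
    have [|N sN] := IHs; first by move=> q qs; apply: sI; rewrite inE qs orbT.
    have [|N' pN'] := sI p; first by rewrite inE eqxx.
    exists (maxn N N') => q; rewrite inE => /orP[/eqP->|qs].
      by apply: I_mono pN'; rewrite leq_maxr.
    by apply: I_mono (sN q qs); rewrite leq_maxl.
  exists (F N); split; last by move/(ideal_of_trans sN); apply: badF.
  exists N.+1; apply: ideal_of_mem; apply/mapP; exists N => //.
  by rewrite mem_iota add0n ltnSn.
(* The condition on [s] stands under the existential, so that choice gives a [pick] defined on all
   sequences. *)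
have fresh_min s : exists p, (forall p, p \in s -> I p) ->
    [/\ I p, ~ ideal_of s p &
        forall q, I q -> ~ ideal_of s q -> (size p <= size q)%N].
  have [sI|sI] := pselect (forall p, p \in s -> I p); last by exists 0.
  pose szP n := `[< exists q, [/\ I q, ~ ideal_of s q & size q = n] >].
  have ex_sz : exists n, szP n.
    by have [p [Ip sp]] := fresh s sI; exists (size p); apply/asboolP; exists p.
  case: (ex_minnP ex_sz) => _ /asboolP[p [Ip sp <-]] p_min.
  exists p => _; split=> // q Iq sq; apply: p_min.
  by apply/asboolP; exists q.
have [pick pickP] := choice fresh_min.
pose g := greedy pick.
have gP n : [/\ I (g n), ~ ideal_of (mkseq g n) (g n) &
    forall q, I q -> ~ ideal_of (mkseq g n) q -> (size (g n) <= size q)%N].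
  elim/ltn_ind: n => n IHn; rewrite /g greedyE; apply: pickP => p.
  by case/mapP=> i; rewrite mem_iota => /andP[_ /IHn[? _ _]] ->.
(* Later choices are made under stronger constraints. Hence the exponents [size (g m) - size (g i)]
   below are true differences. *)
have g_mono i j : (i <= j)%N -> (size (g i) <= size (g j))%N.
  move=> le_ij; have [_ _ -> //] := gP i; first by have [] := gP j.
  have [_ gj _] := gP j; move=> gi; apply: gj; apply: ideal_of_sub gi => q.
  case/mapP=> l; rewrite mem_iota => /andP[_ li] ->.
  by apply/map_f; rewrite mem_iota (leq_trans _ le_ij).
have [m [c lead_m]] := Rn (fun n => lead_coef (g n)).
have [Im gm min_m] := gP m.
pose r := \sum_(i < m) (c i)%:P * 'X^(size (g m) - size (g i)) * g i.
have gr : ideal_of (mkseq g m) r.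
  apply: (@ideal_of_sum _ _ _
    (fun i => (c i)%:P * 'X^(size (g m) - size (g i)) * g i)) => i lt_im.
  by apply/ideal_ofM/ideal_of_mem/map_f; rewrite mem_iota.
have nz_gm : g m != 0.
  by apply/eqP => g0; apply: gm; rewrite g0; apply: ideal_of0.
have szg0 : (0 < size (g m))%N by rewrite size_poly_gt0.
have : (size (g m) <= size (g m - r)%R)%N.
  apply: min_m => [|gmr].
    apply: (ID _ (- r)) => //; rewrite -mulN1r; apply: (IM).
    apply: (big_ind I) => [||i _].
    - by exists 0%N; apply: ideal_of0.
    - by move=> x y; apply: ID.
    - by apply: IM; have [] := gP i.
  by apply: gm; rewrite -(subrK r (g m)); apply: ideal_ofD.
apply/negP; rewrite -ltnNge.
apply: (@leq_ltn_trans (size (g m)).-1); last by rewrite ltn_predL.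
apply/leq_sizeP => j; rewrite leq_eqVlt => /orP[/eqP<-|lt_j].
  rewrite coefB -/(lead_coef (g m)) lead_m coef_sum -sumrB big1 // => i _.
  rewrite -mulrA coefCM coefXnM.
  have le_i : (size (g i) <= size (g m))%N by apply: g_mono; apply: ltnW.
  have nz_gi : g i != 0.
    by apply/eqP => g0; have [_ + _] := gP i; rewrite g0; apply;
      apply: ideal_of0.
  have szgi : (0 < size (g i))%N by rewrite size_poly_gt0.
  rewrite ltnNge -subn1 leq_sub2l //= -subnAC ?subKn // subn1.
  by rewrite -/(lead_coef _) subrr.
have lt_mj : (size (g m) <= j)%N by rewrite -(prednK szg0).
rewrite coefB nth_default // sub0r coef_sum big1 ?oppr0 // => i _.
rewrite -mulrA coefCM coefXnM; case: ifP => [|_]; first by rewrite mulr0.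
rewrite (@nth_default _ _ (g i)) ?mulr0 //.
have le_i : (size (g i) <= size (g m))%N by apply: g_mono; apply: ltnW.
by rewrite -{1}(subKn le_i) leq_sub2r.
Qed.

(** [S] is the polynomial ring over [k] with variables indexed by [I], built by adjoining one
    variable at a time. Identities in [S] are only ever checked after evaluation, so [C] is kept as
    a plain function. *)
Lemma polynomial_functions (k : fieldType) (I : finType) :
  exists (S : comNzRingType) (ev : (I -> k) -> {rmorphism S -> k})
         (C : k -> S) (X : I -> S),
    [/\ noetherian S, forall p c, ev p (C c) = c & forall p i, ev p (X i) = p
      i].
Proof.
suff [S [ev [C [X [Sn evC evX]]]]] :
    exists (S : comNzRingType) (ev : ('I_#|I| -> k) -> {rmorphism S -> k})
           (C : k -> S) (X : 'I_#|I| -> S),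
    [/\ noetherian S, forall p c, ev p (C c) = c & forall p i, ev p (X i) = p
      i].
  exists S, (fun p => ev (p \o enum_val)), C, (X \o enum_rank).
  by split=> // p i; rewrite /= evX /= enum_rankK.
elim: #|I| => [|N [S [ev [C [X [Sn evC evX]]]]]].
  exists k, (fun _ => idfun), id, (fun _ => 0).
  by split=> // [|p []//]; apply: field_noetherian.
pose ev' (p : 'I_N.+1 -> k) : {rmorphism {poly S} -> k} :=
  horner_eval (p ord0) \o map_poly (ev (p \o lift ord0)).
exists {poly S}, ev', (fun c => (C c)%:P),
  (fun i => if unlift ord0 i is Some j then (X j)%:P else 'X).
split=> [|p c|p i]; first exact: poly_noetherian.
  by rewrite /ev' /= map_polyC /= /horner_eval hornerC evC.
rewrite /ev' /= /horner_eval; case: unliftP => [j ->|->].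
  by rewrite map_polyC hornerC; apply: evX.
by rewrite map_polyX hornerX.
Qed.

(* By Noetherian induction: on a minimal closed subset of X on which h takes  *)
(* infinitely many values, nonempty open sets meet, so h would be constant.   *)
Lemma finite_locally_constant (k : fieldType) (S : comNzRingType) (P T : Type)
    (ev : P -> {rmorphism S -> k}) (X : set P) (h : P -> nat -> T) :
    noetherian S ->
    (forall p0 n, X p0 -> exists2 g, ev p0 g != 0 &
       forall p, X p -> ev p g != 0 -> h p n = h p0 n) ->
  finite_set (h @` X).
Proof.
move=> Sn hX; apply: contrapT => infX.
pose Z (s : seq S) := [set p | X p /\ forall f, f \in s -> ev p f = 0].
have step s : exists f, ~ finite_set (h @` Z s) ->
    ~ finite_set (h @` Z (rcons s f)) /\ exists2 p, Z s p & ev p f != 0.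
  apply: contrapT => /forallNP noF; apply: (noF 0) => infs; exfalso.
  have finF f p : Z s p -> ev p f != 0 -> finite_set (h @` Z (rcons s f)).
    move=> Zp fp; apply: contrapT => infsf; apply: (noF f) => _; split=> //.
    by exists p.
  have hZ p0 p1 : Z s p0 -> Z s p1 -> h p0 = h p1.
    move=> Z0 Z1; apply/funext => n.
    have [g0 nz0 hg0] := hX p0 n Z0.1; have [g1 nz1 hg1] := hX p1 n Z1.1.
    have [[p [Zp nz]]|noP] :=
        pselect (exists p, Z s p /\ ev p g0 * ev p g1 != 0).
      (* At a common point [p] of the two open sets, [h p n] equals both values. *)
      move: nz; rewrite mulf_eq0 negb_or => /andP[n0 n1].
      by rewrite -(hg0 p) ?(hg1 p) //; apply: Zp.1.
    case: infs; apply: (@sub_finite_set _ _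
      (h @` Z (rcons s g0) `|` h @` Z (rcons s g1))); last first.
      by rewrite finite_setU; split; [apply: finF nz0 | apply: finF nz1].
    move=> _ [p Zp <-]; have [p0g|nz] := eqVneq (ev p g0) 0.
      left; exists p => //; split=> [|f]; first exact: Zp.1.
      by rewrite mem_rcons inE => /orP[/eqP->|/Zp.2].
    right; exists p => //; split=> [|f]; first exact: Zp.1.
    rewrite mem_rcons inE => /orP[/eqP->|/Zp.2//].
    apply/eqP; apply: contrapT => /negP nz1p; apply: noP; exists p.
    by rewrite mulf_neq0.
  apply: infs; have [[p0 Z0]|noZ] := pselect (exists p, Z s p).
    apply: (@sub_finite_set _ _ [set h p0]); last exact: finite_set1.
    by move=> _ [p Zp <-]; apply: hZ.
  apply: (@sub_finite_set _ _ set0); last exact: finite_set0.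
  by move=> t [p Zp _]; case: noZ; exists p.
(* Add equations greedily, each not vanishing identically on the zero set of the earlier ones. By
   Noetherianity one of them lies in the ideal of its predecessors, so it does vanish there. *)
have [pick pickP] := choice step.
have infG n : ~ finite_set (h @` Z (mkseq (greedy pick) n)).
  elim: n => [|n IHn].
    by move=> fin; apply: infX; apply: (sub_finite_set _ fin) => _ [p Xp <-];
      exists p.
  by have [] := pickP _ IHn; rewrite mkseqS -greedyE.
have [m [c gm]] := Sn (greedy pick).
have [_ [p [Xp Zp]]] := pickP _ (infG m).
rewrite -greedyE gm rmorph_sum big1 ?eqxx // => i _.
by rewrite rmorphM [X in _ * X]Zp ?mulr0 //; apply/map_f; rewrite mem_iota /=.
Qed.

(** * Matrices of polynomials *)

Section PolynomialMatrices.
Variables (k : fieldType) (P : Type) (S : comNzRingType).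
Variables (ev : P -> {rmorphism S -> k}) (C : k -> S).
Hypothesis evC : forall p c, ev p (C c) = c.

Local Notation "M @[ p ]" := (map_mx (ev p) M)
  (at level 2, left associativity, format "M @[ p ]").
Local Notation "M ^%" := (map_mx C M) (at level 2, format "M ^%").

Lemma evK p m n (M : 'M[k]_(m, n)) : M^%@[p] = M.
Proof. by apply/matrixP => i j; rewrite !mxE evC. Qed.

(** Write a basis of the sum at [p0] as combinations of the rows of the [M i], and keep these
    coefficients and a right inverse of the basis fixed while [p] varies. The product has a
    determinant polynomial in [p], equal to 1 at [p0]; where it is nonzero, the rank is at least the
    one at [p0]. The family form serves for the sum of subspaces that makes up a kernel. *)
Lemma rank_lower_semicontinuous (I : finType) (m : I -> nat) n
    (M : forall i, 'M[S]_(m i, n)) p0 :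
  exists2 g, ev p0 g != 0 & forall p, ev p g != 0 ->
    (\rank (\sum_i <<(M i)@[p0]>>)%MS <= \rank (\sum_i <<(M i)@[p]>>)%MS)%N.
Proof.
set V := (\sum_i _)%MS.
have /sub_sumsmxP[u Bu] : (row_base V <= V)%MS by rewrite eq_row_base.
have /row_freeP[B' BB'] := row_base_free V.
pose L i := u i *m (<<(M i)@[p0]>>%MS *m pinvmx (M i)@[p0]).
have Lu i : u i *m <<(M i)@[p0]>>%MS = L i *m (M i)@[p0].
  by rewrite -mulmxA mulmxKpV // genmxE.
pose G := (\sum_i (L i)^% *m M i) *m B'^%.
have Gp p : ev p (\det G) = \det ((\sum_i L i *m (M i)@[p]) *m B').
  rewrite -det_map_mx map_mxM evK; congr (\det (_ *m _)).
  by rewrite map_mx_sum; apply: eq_bigr => i _; rewrite map_mxM evK.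
exists (\det G) => [|p].
  rewrite Gp; under eq_bigr do rewrite -Lu.
  by rewrite -Bu BB' det1 oner_neq0.
rewrite Gp -unitfE -unitmxE => unitG; rewrite -{1}(mxrank_unit unitG).
apply: leq_trans (mxrankM_maxl _ _) (mxrankS _).
apply: summx_sub => i _; apply: (@submx_trans _ _ _ _ _ _ <<(M i)@[p]>>%MS).
  by rewrite genmxE submxMl.
exact: sumsmx_sup (submx_refl _).
Qed.

(* If the rank of M is locally r and P0 M(p0) Q0 = 1 of size r, then near p0  *)
(* the kernel of M is the row space of 1 - M Q0 (P0 M Q0)^-1 P0.              *)
Lemma kernel_param m n (M : 'M[S]_(m, n)) p0 :
  exists (B : 'M[S]_m) g, ev p0 g != 0 /\ forall p, ev p g != 0 ->
    \rank M@[p] = \rank M@[p0] -> (kermx M@[p] :=: B@[p])%MS.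
Proof.
have /submxP[P0 defB] : (row_base M@[p0] <= M@[p0])%MS by rewrite eq_row_base.
have /row_freeP[Q0 PQ] := row_base_free M@[p0].
set r := \rank _ in P0 defB Q0 PQ *.
pose al := P0^% *m M *m Q0^%.
(* Multiplying by the determinant clears the inverse and changes no row space where it is
   nonzero. *)
exists ((\det al)%:M - M *m Q0^% *m \adj al *m P0^%), (\det al).
have alp p : al@[p] = P0 *m M@[p] *m Q0 by rewrite !map_mxM !evK.
split=> [|p nz rp]; first by rewrite -det_map_mx alp -defB PQ det1 oner_neq0.
rewrite map_mxB map_scalar_mx !map_mxM !evK map_mx_adj.
set Mp := M@[p]; set E := (_ - _).
have ual : al@[p] \in unitmx by rewrite unitmxE det_map_mx unitfE.
(* The rows of [P0 *m Mp] lie in the row space of [Mp] and, [al] being invertible at [p], already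
   have its full rank. *)
have /submxP[Y MY] : (Mp <= P0 *m Mp)%MS.
  have sPM : (P0 *m Mp <= Mp)%MS by apply: submxMl.
  rewrite -(mxrank_leqif_sup sPM) eqn_leq mxrankS //= rp -/r.
  by rewrite -{1}(mxrank_unit ual) alp mxrankM_maxl.
have EM : E *m Mp = 0.
  have MQ : Mp *m Q0 = Y *m al@[p] by rewrite alp -/Mp {1}MY !mulmxA.
  rewrite mulmxBl mul_scalar_mx MQ -(mulmxA Y) mul_mx_adj det_map_mx.
  by rewrite mul_mx_scalar -!scalemxAl -mulmxA -MY subrr.
apply/eqmxP/andP; split; last exact/sub_kermxP.
have -> : kermx Mp = ((ev p (\det al))^-1 *: kermx Mp) *m E.
  rewrite mulmxBr -!mulmxA -!scalemxAl (mulmxA (kermx _)) mulmx_ker mul0mx.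
  by rewrite scaler0 subr0 mul_mx_scalar scalerA mulVf // scale1r.
exact: submxMl.
Qed.

(** The rank of [M n] cannot drop near [p0]. Neither can its nullity: the kernels in degrees at most
    [e] have constant dimension on [X], so [kernel_param] gives them polynomial spanning matrices,
    and the kernel of [M n] is a sum of images of these. Rank and nullity add up to [r n], so both
    are constant near [p0]. *)
Lemma rank_locally_constant (r c : nat -> nat) (e : nat)
    (M : forall n, 'M[S]_(r n, c n)) (eta : nat -> nat)
    (J : nat -> finType) (dg : forall n, J n -> nat)
    (N : forall n (j : J n), 'M[k]_(r (dg n j), r n)) (X : set P) :
    (forall n j, dg n j <= e)%N ->
    (forall p, X p -> forall m, (m <= e)%N -> \rank (M m)@[p] = eta m) ->
    (forall p, X p -> forall n, (e < n)%N ->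
      (kermx (M n)@[p] :=: \sum_j <<kermx (M (dg n j))@[p] *m N n j>>)%MS) ->
  forall p0 n, X p0 -> exists2 g, ev p0 g != 0 &
    forall p, X p -> ev p g != 0 -> \rank (M n)@[p] = \rank (M n)@[p0].
Proof.
move=> dge Xr Xk p0 n Xp0; have [le_ne|lt_en] := leqP n e.
  by exists 1 => [|p Xp _]; rewrite ?rmorph1 ?oner_neq0 // !Xr.
have [g1 nz1 le1] := @rank_lower_semicontinuous unit (fun=> r n) _ (fun=> M n)
  p0.
have sum1 (p : P) : \rank (\sum_(i : unit) <<(M n)@[p]>>)%MS = \rank (M n)@[p].
  by rewrite (big_pred1 tt) ?genmxE //; case.
pose kp j := @kernel_param _ _ (M (dg n j)) p0.
pose B j := projT1 (cid (kp j));
  have [g Bg] := choice (fun j => projT2 (cid (kp j))).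
rewrite -/(B _) in Bg.
have [g2 nz2 le2] := @rank_lower_semicontinuous (J n) (fun j => r (dg n j)) _
  (fun j => B j *m (N n j)^%) p0.
exists (g1 * g2 * \prod_j g j) => [|p Xp].
  rewrite !rmorphM rmorph_prod !mulf_neq0 //; apply/prodf_neq0 => j _.
  by have [] := Bg j.
rewrite !rmorphM rmorph_prod !mulf_eq0 !negb_or -andbA => /and3P[n1 n2].
move=> /prodf_neq0 nzg.
have kerE q : X q -> (forall j, ev q (g j) != 0) ->
    (r n - \rank (M n)@[q])%N = \rank (\sum_j <<(B j *m (N n j)^%)@[q]>>)%MS.
  move=> Xq nzq; rewrite -mxrank_ker (Xk q) //; apply: eqmx_rank.
  apply/eqmxP; apply: eqmx_sums => j _; rewrite map_mxM evK.
  apply: (eqmx_trans (genmxE _)); apply: eqmx_trans (eqmx_sym (genmxE _)).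
  by apply: eqmxMr; apply: (Bg j).2; rewrite ?nzq // !Xr.
have := le1 p n1; have := le2 p n2; rewrite !sum1 -!kerE //; last first.
- by move=> j; have [] := Bg j.
- by move=> j; apply: nzg.
rewrite leq_sub2lE ?rank_leq_row // => ge lt.
by apply/eqP; rewrite eqn_leq ge.
Qed.

End PolynomialMatrices.

(** * Graded algebras *)

(** Take a matrix of maximal rank among those whose row space lies in [U]. *)
Lemma rowspace_of_subspace (k : fieldType) n (U : 'rV[k]_n -> Prop) :
    U 0 -> (forall a u v, U u -> U v -> U (a *: u + v)) ->
  exists W : 'M[k]_n, forall v, U v <-> (v <= W)%MS.
Proof.
move=> U0 UD.
pose ok r := `[< exists W : 'M[k]_n,
  (forall v : 'rV_n, (v <= W)%MS -> U v) /\ \rank W = r >].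
have ok0 : exists r, ok r.
  exists 0%N; apply/asboolP; exists 0; split=> [v|]; last exact: mxrank0.
  by rewrite submx0 => /eqP->.
have ok_le r : ok r -> (r <= n)%N by move/asboolP=> [W [_ <-]];
  apply: rank_leq_row.
case: (ex_maxnP ok0 ok_le) => _ /asboolP[W [WU <-]] Wmax.
exists W => v; split=> [Uv|]; last exact: WU.
apply: contrapT => /negP nWv.
have /Wmax : ok (\rank (W + v)%MS).
  apply/asboolP; exists (W + v)%MS; split=> // w /sub_addsmxP[[u1 u2] /= ->].
  rewrite addrC [u2]mx11_scalar mul_scalar_mx; apply: UD => //.
  by apply: WU; apply: submxMl.
apply/negP; rewrite -ltnNge rank_ltmx // /ltmx addsmxSl /=.
by apply: contra nWv; apply: submx_trans; apply: addsmxSr.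
Qed.

(** A spanning family of least size is free: a nontrivial relation would allow one member to be
    dropped. *)
Lemma basis_of_span (k : fieldType) (V : lmodType k) (U : V -> Prop) r
    (g : 'I_r -> V) :
    (forall i, U (g i)) ->
    (forall u, U u -> exists c : 'rV_r, u = \sum_i c 0 i *: g i) ->
  exists D (e : 'I_D -> V), [/\ forall i, U (e i),
    forall u, U u -> exists c : 'rV_D, u = \sum_i c 0 i *: e i &
    forall c : 'rV_D, \sum_i c 0 i *: e i = 0 -> c = 0].
Proof.
move=> gU gs.
pose ok r := `[< exists g : 'I_r -> V, (forall i, U (g i)) /\
  (forall u, U u -> exists c : 'rV_r, u = \sum_i c 0 i *: g i) >].
have ok_r : exists r, ok r by exists r; apply/asboolP; exists g.
case: (ex_minnP ok_r) => {r g gU gs ok_r} r /asboolP[g [gU gs]] rmin.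
exists r, g; split=> // c gc; apply/rowP => i0; rewrite mxE.
apply/eqP; apply: contrapT => /negP nz.
case: r g gU gs rmin c gc i0 nz => [|r] g gU gs rmin c gc i0 nz.
  by case: i0 nz.
suff /rmin : ok r by rewrite ltnn.
apply/asboolP; exists (g \o lift i0); split=> [i|u /gs[a ->]]; first exact: gU.
(* Subtracting a multiple of the relation [c] kills the coefficient at [i0]. *)
pose b i := a 0 i - a 0 i0 / c 0 i0 * c 0 i.
exists (\row_i b (lift i0 i)).
have -> : \sum_i a 0 i *: g i = \sum_i b i *: g i.
  apply/esym; under eq_bigr do rewrite scalerBl -scalerA.
  by rewrite sumrB -scaler_sumr gc scaler0 subr0.
rewrite (bigD1_ord i0) //= /b divfK // subrr scale0r add0r.
by apply: eq_bigr => i _; rewrite mxE.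
Qed.

Lemma submod_rpredB (R : pzRingType) (V : lmodType R) (W : submodClosed V) x y :
  x \in W -> y \in W -> x - y \in W.
Proof. by have [_] := GRing.submod_closedB (submodClosedP W); apply. Qed.

Section GradedAlgebraTheory.
Variables (k : fieldType) (A : algType k) (A_ : nat -> submodClosed A).
Hypothesis gr : connected_graded A_.

Definition is_decomp (a : A) (c : nat -> A) (N : nat) : Prop :=
  [/\ forall i, c i \in A_ i, forall i, (N <= i)%N -> c i = 0 &
      a = \sum_(i < N) c i].

Definition gcomp (n : nat) (a : A) : A :=
  xget 0 [set x | exists c N, is_decomp a c N /\ x = c n].

Lemma sum_trunc (c : nat -> A) N M :
    (N <= M)%N -> (forall i, (N <= i)%N -> c i = 0) ->
  \sum_(i < N) c i = \sum_(i < M) c i.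
Proof.
move=> le_NM c0; rewrite -!(big_mkord xpredT) (big_cat_nat _ le_NM) //=.
rewrite [X in _ = _ + X]big_nat_cond [X in _ = _ + X]big1 ?addr0 // => i.
by rewrite andbT => /andP[/c0].
Qed.

Lemma decomp_uniq a c N c' N' :
  is_decomp a c N -> is_decomp a c' N' -> c =1 c'.
Proof.
move=> [cA c0 ac] [c'A c'0 ac'] n.
pose M := maxn n.+1 (maxn N N').
have le_nM : (n < M)%N by rewrite leq_maxl.
have le_NM : (N <= M)%N by rewrite /M !leq_max leqnn orbT.
have le_N'M : (N' <= M)%N by rewrite /M !leq_max leqnn !orbT.
apply/eqP; rewrite -subr_eq0; apply/eqP.
apply: (grade_indep gr (c := fun i => c i - c' i)) le_nM => [i|].
  exact: submod_rpredB.
by rewrite sumrB -(sum_trunc le_NM) // -(sum_trunc le_N'M) // -ac -ac' subrr.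
Qed.

Lemma decomp_ex a : exists c N, is_decomp a c N.
Proof.
have [N [c [cA ->]]] := grade_span gr a.
exists (fun i => if (i < N)%N then c i else 0), N; split=> [i|i|].
- by case: ifP => _; rewrite ?rpred0 //; apply: cA.
- by rewrite leqNgt => /negPf->.
- by apply: eq_bigr => i _; rewrite ltn_ord.
Qed.

Lemma gcompP a c N n : is_decomp a c N -> gcomp n a = c n.
Proof.
move=> acN; apply: xget_unique => [|x [c' [N' [/decomp_uniq/(_ acN) cc' ->]]]].
  by exists c, N.
exact: cc'.
Qed.

Lemma gcomp_decomp a : exists N, is_decomp a (gcomp^~ a) N.
Proof.
have [c [N acN]] := decomp_ex a.
by exists N; have <- : c = gcomp^~ a by apply/funext => n;
  rewrite (gcompP _ acN).
Qed.

Lemma gcomp_in n a : gcomp n a \in A_ n.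
Proof. by have [N []] := gcomp_decomp a. Qed.

Lemma gcomp_hom m n a : a \in A_ m -> gcomp n a = if m == n then a else 0.
Proof.
move=> aA; apply: (@gcompP a (fun i => if m == i then a else 0) m.+1).
split=> [i|i|]; first by case: eqP => [<-|]; rewrite ?rpred0.
  by move=> /ltn_eqF->.
rewrite big_ord_recr /= eqxx big1 ?add0r // => i _.
by rewrite eq_sym (ltn_eqF (ltn_ord i)).
Qed.

Lemma gcomp_id n a : a \in A_ n -> gcomp n a = a.
Proof. by move=> /(gcomp_hom n) ->; rewrite eqxx. Qed.

Lemma gcomp_linear n x a b : gcomp n (x *: a + b) = x *: gcomp n a + gcomp n b.
Proof.
have [N [aA a0 aE]] := gcomp_decomp a; have [N' [bA b0 bE]] := gcomp_decomp b.
apply: (@gcompP _ (fun i => x *: gcomp i a + gcomp i b) (maxn N N')).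
split=> [i|i|]; first by rewrite rpredD ?rpredZ.
  by rewrite geq_max => /andP[/a0-> /b0->]; rewrite scaler0 addr0.
rewrite big_split /= -scaler_sumr {1}aE {1}bE.
by rewrite (sum_trunc (leq_maxl N N') a0) (sum_trunc (leq_maxr N N') b0).
Qed.

Lemma gcomp0 n : gcomp n 0 = 0.
Proof. by rewrite (@gcomp_hom n) ?rpred0 // eqxx. Qed.

Lemma gcompD n a b : gcomp n (a + b) = gcomp n a + gcomp n b.
Proof. by rewrite -[a]scale1r gcomp_linear !scale1r. Qed.

Lemma gcompZ n x a : gcomp n (x *: a) = x *: gcomp n a.
Proof. by rewrite -[x *: a]addr0 gcomp_linear gcomp0 addr0. Qed.

Lemma gcompB n a b : gcomp n (a - b) = gcomp n a - gcomp n b.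
Proof. by rewrite gcompD -scaleN1r gcompZ scaleN1r. Qed.

Lemma gcomp_sum n (I : Type) (s : seq I) (Q : pred I) (F : I -> A) :
  gcomp n (\sum_(i <- s | Q i) F i) = \sum_(i <- s | Q i) gcomp n (F i).
Proof. exact: (big_morph _ (gcompD n) (gcomp0 n)). Qed.

Lemma gcomp_sumE a : exists N, forall M, (N <= M)%N -> a = \sum_(i < M) gcomp i
  a.
Proof.
have [N [_ a0 aE]] := gcomp_decomp a.
by exists N => M le_NM; rewrite {1}aE (sum_trunc le_NM a0).
Qed.

Lemma gcompMl m n x a : x \in A_ m ->
  gcomp n (x * a) = if (m <= n)%N then x * gcomp (n - m) a else 0.
Proof.
move=> xA; have [N aN] := gcomp_sumE a.
rewrite {1}(aN (maxn N n.+1)) ?leq_maxl // mulr_sumr gcomp_sum.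
under eq_bigr => i _.
  rewrite (@gcomp_hom (m + i)); last by apply: (grade_mul gr) => //;
    apply: gcomp_in.
  over.
case: leqP => [le_mn|lt_nm]; last first.
  by rewrite big1 // => i _; rewrite eq_sym ltn_eqF // ltn_addr.
have lt_M : (n - m < maxn N n.+1)%N by rewrite leq_max orbC ltnS leq_subr.
rewrite (bigD1 (Ordinal lt_M)) //= subnKC // eqxx big1 ?addr0 // => i.
by rewrite -val_eqE /= => ne; case: eqP => // E; case/eqP: ne;
  rewrite -[X in (X - m)%N]E addKn.
Qed.

Lemma gcompMr m n x a : a \in A_ m ->
  gcomp n (x * a) = if (m <= n)%N then gcomp (n - m) x * a else 0.
Proof.
move=> aA; have [N xN] := gcomp_sumE x.
rewrite {1}(xN (maxn N n.+1)) ?leq_maxl // mulr_suml gcomp_sum.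
under eq_bigr => i _.
  rewrite (@gcomp_hom (i + m)); last by apply: (grade_mul gr) => //;
    apply: gcomp_in.
  over.
case: leqP => [le_mn|lt_nm]; last first.
  by rewrite big1 // => i _; rewrite eq_sym ltn_eqF // ltn_addl.
have lt_M : (n - m < maxn N n.+1)%N by rewrite leq_max orbC ltnS leq_subr.
rewrite (bigD1 (Ordinal lt_M)) //= subnK // eqxx big1 ?addr0 // => i.
by rewrite -val_eqE /= => ne; case: eqP => // E; case/eqP: ne;
  rewrite -[X in (X - m)%N]E addnK.
Qed.

Lemma homogeneous_gcomp (I : right_ideal A) n x :
  homogeneous A_ I -> x \in I -> gcomp n x \in I.
Proof.
move=> Ih /Ih[N [c [cI xE]]].
have -> : gcomp n x = if (n < N)%N then c n else 0.
  apply: (@gcompP _ (fun i => if (i < N)%N then c i else 0) N).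
  split=> [i|i|]; first by case: ifP => _; rewrite ?rpred0 //; apply: (cI i).2.
    by rewrite leqNgt => /negPf->.
  by rewrite xE; apply: eq_bigr => i _; rewrite ltn_ord.
by case: ifP => _; [apply: (cI n).1 | apply: rpred0].
Qed.

End GradedAlgebraTheory.

(** * Generated submodules and right ideals *)

Lemma gen_submod_ind (R : pzRingType) (V : lmodType R) (T : set V)
    (Q : V -> Prop) :
    Q 0 -> (forall a x y, Q x -> Q y -> Q (a *: x + y)) ->
    (forall y, T y -> Q y) ->
  forall x, x \in gen_submod T -> Q x.
Proof.
move=> Q0 QD QT x /asboolP Tx.
pose W : {pred V} := fun y => `[< Q y >].
have Wc : submod_closed W.
  split=> [|a y z /asboolP Qy /asboolP Qz]; apply/asboolP => //.
  exact: QD.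
pose Wp : submodClosed V := HB.pack W (GRing.isSubmodClosed.Build R V W Wc).
have /asboolP // : x \in Wp.
by apply: Tx => y /QT Qy; apply/asboolP.
Qed.

Lemma mem_gen_submod (R : pzRingType) (V : lmodType R) (T : set V) x :
  T x -> x \in gen_submod T.
Proof. by move=> Tx; apply/asboolP => W; apply. Qed.

Section RightIdeals.
Variables (k : fieldType) (A : algType k).
Implicit Types (I : right_ideal A) (x y : A).

Lemma rideal0 I : (0 : A) \in I. Proof. exact: (rpred0 I). Qed.

Lemma ridealD I x y : x \in I -> y \in I -> x + y \in I.
Proof. exact: (@rpredD _ I). Qed.

Lemma ridealZ I (c : k) x : x \in I -> c *: x \in I.
Proof. by move=> xI; rewrite -[x]mulr1 scalerAr right_idealM. Qed.

Lemma ridealN I x : x \in I -> - x \in I.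
Proof. by rewrite -scaleN1r; apply: ridealZ. Qed.

Lemma rideal_sum I (J : Type) (r : seq J) (P : pred J) (F : J -> A) :
  (forall i, P i -> F i \in I) -> \sum_(i <- r | P i) F i \in I.
Proof.
move=> FI; elim/big_ind: _ => //; [exact: rideal0 | exact: ridealD].
Qed.

End RightIdeals.

(** * Finite dimension of the graded components *)

(** By surjectivity of [phi], the algebra is spanned by words in the images of the variables, and a
    word is 1 or a letter times a shorter word. *)
Lemma finitely_presented_ind (k : fieldType) (A : algType k) :
    finitely_presented A ->
  exists n (g : 'I_n -> A), forall Q : A -> Prop, Q 1 ->
    (forall i a, Q a -> Q (g i * a)) ->
    (forall c a b, Q a -> Q b -> Q (c *: a + b)) -> forall a, Q a.
Proof.
move=> [n [phi [r [surj _]]]].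
exists n, (fun i => phi << fmu i >>) => Q Q1 Qg QD a.
have Q0 : Q 0 by have := QD (-1) 1 1 Q1 Q1; rewrite scaleN1r addNr.
have [{a}g <-] := surj a; rewrite [g]monalgE raddf_sum.
elim/big_ind: _ => // [x y Qx|m _]; first by rewrite -[x]scale1r; apply: QD.
have -> : << g@_m *g m >> = g@_m *: << m >> :> {malg k[{fmonom 'I_n}]}.
  by apply/malgP => l; rewrite mcoeffZ !mcoeffU mulrnAr mulr1.
rewrite -[X in Q X]/(phi (g@_m *: << m >>)) linearZ_LR -[_ *: _]addr0;
  apply: QD => //.
case: m => s; elim: s => [|i s IHs].
  have -> : << FMonom [::] >> = 1 :> {malg k[{fmonom 'I_n}]}.
    by rewrite -mpolyC1E; congr << _ >>; rewrite -fmoneE.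
  by rewrite rmorph1.
have -> : << FMonom (i :: s) >> = << fmu i >> * << FMonom s >>
    :> {malg k[{fmonom 'I_n}]}.
  by rewrite malgM_def fgmulUU mulr1; congr << _ >>;
    rewrite -[RHS]/(fmmul _ _) fmuE fmmulE.
by rewrite rmorphM; apply: Qg.
Qed.

(** The generators need not be homogeneous, so the letters in [G] are their components of degrees 1
    to [J]; components of degree 0 are scalars. Each letter has positive degree, hence words of
    length at most [J] suffice in degree [J]. *)
Lemma grade_span_finite (k : fieldType) (A : algType k)
    (A_ : nat -> submodClosed A) (J : nat) :
    connected_graded A_ -> finitely_presented A ->
  exists r (g : 'I_r -> A), (forall i, g i \in A_ J) /\
    forall a, a \in A_ J -> exists c : 'rV_r, a = \sum_i c 0 i *: g i.
Proof.
move=> gr /finitely_presented_ind[n [g gind]].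
pose G := [seq gcomp A_ u (g i) | u <- iota 1 J, i <- enum 'I_n].
pose W := fix W f := if f is f'.+1 then 1 :: [seq x * w | x <- G, w <- W f']
  else [:: 1 : A].
have W1 f : 1 \in W f by case: f => [|f]; rewrite inE eqxx.
have WG f j : (j <= f)%N -> (j <= J)%N -> forall a,
    gcomp A_ j a \in gen_submod [set x | x \in W f].
  elim: f j => [|f IHf] j le_jf le_jJ a.
    move: le_jf; rewrite leqn0 => /eqP->.
    have /(grade_connected gr)[c ->] := gcomp_in gr 0 a.
    by apply/rpredZ/mem_gen_submod; apply: (W1 0%N).
  move: a j le_jf le_jJ; apply: gind => [|i a IHa|c a b IHa IHb] j le_jf le_jJ.
  - rewrite (gcomp_hom gr (m := 0)); last first.
      by apply/(grade_connected gr); exists 1; rewrite scale1r.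
    by case: ifP => _; [apply/mem_gen_submod/W1 | apply: rpred0].
  - have [N gN] := gcomp_sumE gr (g i).
    rewrite (gN N (leqnn _)) mulr_suml (gcomp_sum gr); apply: rpred_sum => u _.
    rewrite (gcompMl gr _ _ (gcomp_in gr u _)).
    case: ifP => le_uj; last exact: rpred0.
    case: (posnP u) => [u0|u_gt0].
      rewrite u0 subn0; have /(grade_connected gr)[c ->] := gcomp_in gr 0 (g i).
      by rewrite -scalerAl mul1r rpredZ // IHa.
    have /IHf : (j - u <= f)%N.
      by rewrite leq_subLR (leq_trans le_jf) // -add1n leq_add2r.
    move=> /(_ (leq_trans (leq_subr _ _) le_jJ) a).
    set z := gcomp A_ (j - u) a; move: z;
      apply: gen_submod_ind => [|c x y Qx Qy|w /= wW].
    + by rewrite mulr0 rpred0.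
    + by rewrite mulrDr -scalerAr rpredD ?rpredZ.
    apply: mem_gen_submod; rewrite /= inE; apply/orP; right.
    apply/allpairsP; exists (gcomp A_ u (g i), w); split=> //.
    apply/allpairsP; exists (nat_of_ord u, i); split=> //=.
      by rewrite mem_iota u_gt0 add1n ltnS (leq_trans le_uj).
    by rewrite mem_enum.
  by rewrite (gcomp_linear gr) rpredD ?rpredZ ?IHa ?IHb.
exists (size (W J)), (fun i => gcomp A_ J (W J)`_i).
split=> [i|a aJ]; first exact: gcomp_in.
have : a \in gen_submod [set x | x \in W J] by rewrite -(gcomp_id gr aJ) WG.
rewrite -{2}(gcomp_id gr aJ); move: a {aJ}.
apply: gen_submod_ind => [|c x y [u xu] [v yv]|w /= wW].
- by exists 0; rewrite (gcomp0 gr) big1 // => i _; rewrite mxE scale0r.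
- exists (c *: u + v); rewrite (gcomp_linear gr) xu yv scaler_sumr -big_split.
  by apply: eq_bigr => i _; rewrite !mxE scalerDl scalerA.
have lt_w : (index w (W J) < size (W J))%N by rewrite index_mem.
exists (delta_mx 0 (Ordinal lt_w)); rewrite (bigD1 (Ordinal lt_w)) //= big1.
  by rewrite mxE !eqxx scale1r nth_index // addr0.
by move=> i /negPf ne; rewrite mxE ne andbF scale0r.
Qed.

Lemma grade_basis (k : fieldType) (A : algType k) (A_ : nat -> submodClosed A) :
    connected_graded A_ -> finitely_presented A ->
  exists (D : nat -> nat) (e : forall n, 'I_(D n) -> A), forall n,
    [/\ forall i, e n i \in A_ n,
        forall a, a \in A_ n -> exists c : 'rV_(D n), a = \sum_i c 0 i *: e n i
          &
        forall c : 'rV_(D n), \sum_i c 0 i *: e n i = 0 -> c = 0].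
Proof.
move=> gr fp.
have ex_basis n : exists D (e : 'I_D -> A), [/\ forall i, e i \in A_ n,
        forall a, a \in A_ n -> exists c : 'rV_D, a = \sum_i c 0 i *: e i &
        forall c : 'rV_D, \sum_i c 0 i *: e i = 0 -> c = 0].
  have [r [g [gA gs]]] := grade_span_finite n gr fp.
  exact: (basis_of_span gA gs).
exists (fun n => projT1 (cid (ex_basis n))).
exists (fun n => projT1 (cid (projT2 (cid (ex_basis n))))) => n.
exact: projT2 (cid (projT2 (cid (ex_basis n)))).
Qed.

(** * Coordinates and Hilbert series as ranks *)

Section Coordinates.
Variables (k : fieldType) (A : algType k) (A_ : nat -> submodClosed A).
Variables (D : nat -> nat) (e : forall n, 'I_(D n) -> A).

Definition gvec n (v : 'rV[k]_(D n)) : A := \sum_i v 0 i *: e i.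

Fact gvec_is_linear n : linear (@gvec n).
Proof.
move=> a u v; rewrite scaler_sumr -big_split; apply: eq_bigr => i _.
by rewrite !mxE scalerDl scalerA.
Qed.

HB.instance Definition _ n := GRing.isLinear.Build k 'rV[k]_(D n) A *:%R (@gvec
  n)
  (@gvec_is_linear n).

Definition gcoord n (a : A) : 'rV[k]_(D n) :=
  xget 0 [set v | gcomp A_ n a = gvec v].

Hypothesis gr : connected_graded A_.
Hypothesis eP : forall n,
  [/\ forall i, @e n i \in A_ n,
      forall a, a \in A_ n -> exists c : 'rV_(D n), a = \sum_i c 0 i *: e i &
      forall c : 'rV_(D n), \sum_i c 0 i *: e i = 0 -> c = 0].

Lemma gvec_in n (v : 'rV_(D n)) : gvec v \in A_ n.
Proof. by apply: rpred_sum => i _; apply: rpredZ; have [] := eP n. Qed.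

Lemma gcoordK n a : gvec (gcoord n a) = gcomp A_ n a.
Proof.
have [_ /(_ _ (gcomp_in gr n a))[c ac] _] := eP n.
have c_ac : [set v | gcomp A_ n a = gvec v] c by [].
by rewrite -(xgetPex 0 (ex_intro _ c c_ac)).
Qed.

Lemma gvec_inj n : injective (@gvec n).
Proof.
move=> u v uv; apply/eqP; rewrite -subr_eq0; apply/eqP.
by have [_ _] := eP n; apply; rewrite -/(gvec _) linearB /= uv subrr.
Qed.

Lemma gvecK n : cancel (@gvec n) (gcoord n).
Proof. by move=> v; apply: gvec_inj; rewrite gcoordK gcomp_id // gvec_in. Qed.

Lemma gcoord_linear n x a b : gcoord n (x *: a + b) = x *: gcoord n a + gcoord
  n b.
Proof.
by apply: gvec_inj; rewrite gcoordK gcomp_linear // linearP /= !gcoordK.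
Qed.

Lemma gcoord0 n : gcoord n 0 = 0.
Proof. by apply: gvec_inj; rewrite gcoordK gcomp0 // linear0. Qed.

Lemma gcoordD n a b : gcoord n (a + b) = gcoord n a + gcoord n b.
Proof. by rewrite -[a]scale1r gcoord_linear !scale1r. Qed.

Lemma gcoordZ n x a : gcoord n (x *: a) = x *: gcoord n a.
Proof. by rewrite -[x *: a]addr0 gcoord_linear gcoord0 addr0. Qed.

Lemma gcoord_sum n (I : Type) (s : seq I) (Q : pred I) (F : I -> A) :
  gcoord n (\sum_(i <- s | Q i) F i) = \sum_(i <- s | Q i) gcoord n (F i).
Proof. exact: (big_morph _ (@gcoordD n) (gcoord0 n)). Qed.

Lemma gvec_mulmx n r (u : 'rV_r) (B : 'M_(r, D n)) :
  gvec (u *m B) = \sum_i u 0 i *: gvec (row i B).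
Proof. by rewrite mulmx_sum_row linear_sum;
  under eq_bigr do rewrite linearZ. Qed.

Implicit Types I J : right_ideal A.

Section HilbertRank.
Variables (I : right_ideal A) (n m : nat) (M : 'M[k]_(m, D n)).
Hypothesis IM : forall v : 'rV_(D n), gvec v \in I <-> (v <= M)%MS.

Lemma basis_size_rank r (b : 'I_r -> A) :
  is_basis (component A_ I n) b -> r = \rank M.
Proof.
move=> [bI bP]; pose B := \matrix_i gcoord n (b i).
have vB i : gvec (row i B) = b i.
  by rewrite rowK gcoordK gcomp_id //; case: (bI i).
have freeB : row_free B.
  rewrite -kermx_eq0; apply/rowV0P => u /sub_kermxP uB.
  have /bP[c [_ c_uniq]] : component A_ I n 0.
    by split; [apply: rideal0 | apply: rpred0].
  have cu : c = [ffun i => u 0 i].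
    apply: c_uniq; under eq_bigr do rewrite ffunE -vB.
    by rewrite -gvec_mulmx uB linear0.
  have c0 : c = [ffun=> 0].
    by apply: c_uniq; rewrite big1 // => i _; rewrite ffunE scale0r.
  apply/rowP => i; move: cu; rewrite c0 => /ffunP/(_ i); rewrite !ffunE => <-.
  by rewrite mxE.
rewrite -(eqP freeB); apply: eqmx_rank; apply/andP; split.
  by apply/row_subP => i; apply/IM; rewrite vB; case: (bI i).
apply/row_subP => i; have /IM iI := row_sub i M.
have /bP[c [vc _]] : component A_ I n (gvec (row i M)) by split;
  last exact: gvec_in.
have -> : row i M = (\row_i c i) *m B.
  by apply: gvec_inj; rewrite gvec_mulmx vc; apply: eq_bigr => j _;
    rewrite mxE vB.
exact: submxMl.
Qed.

(** [row_base M] supplies a basis, and [basis_size_rank] shows that every basis has this size, so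
    [xget] returns it. *)
Lemma hilbert_series_rank : hilbert_series A_ I n = \rank M.
Proof.
rewrite /hilbert_series /subspace_dim; apply: xget_unique => /=; last first.
  by move=> r [b]; apply: basis_size_rank.
exists (fun i => gvec (row i (row_base M))); split=> [i|u [uI uA]].
  split; last exact: gvec_in.
  by apply/IM; rewrite -(eq_row_base M) row_sub.
have /submxP[c uc] : (gcoord n u <= row_base M)%MS.
  by rewrite eq_row_base; apply/IM; rewrite gcoordK gcomp_id.
have uE : u = gvec (gcoord n u) by rewrite gcoordK gcomp_id.
exists [ffun i => c 0 i]; split.
  rewrite [LHS]uE uc gvec_mulmx; apply: eq_bigr => i _; by rewrite ffunE.
move=> c' uc'; apply/ffunP => i; rewrite ffunE.
suff -> : c = \row_i c' i by rewrite mxE.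
apply: (row_free_inj (row_base_free M)); rewrite -uc; apply: gvec_inj.
by rewrite -uE {1}uc' gvec_mulmx; apply: eq_bigr => j _; rewrite mxE.
Qed.

End HilbertRank.

Lemma ideal_rowspace I n :
  exists M : 'M[k]_(D n), forall v : 'rV_(D n), gvec v \in I <-> (v <= M)%MS.
Proof.
apply: (@rowspace_of_subspace _ _ (fun v => gvec v \in I)).
  by rewrite linear0; apply: rideal0.
by move=> a u v uI vI; rewrite linearP; apply: ridealD => //; apply: ridealZ.
Qed.

Lemma hilbert_series_le_dim I n : (hilbert_series A_ I n <= D n)%N.
Proof.
by have [M IM] := ideal_rowspace I n;
  rewrite (hilbert_series_rank IM) rank_leq_row.
Qed.

Lemma hilbert_series_le I J n : {subset J <= I} ->
  (hilbert_series A_ J n <= hilbert_series A_ I n)%N.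
Proof.
move=> sJI; have [M IM] := ideal_rowspace I n;
  have [N JN] := ideal_rowspace J n.
rewrite (hilbert_series_rank IM) (hilbert_series_rank JN); apply: mxrankS.
by apply/row_subP => i; apply/IM/sJI/JN/row_sub.
Qed.

Lemma hilbert_series_lt I J n x : {subset J <= I} ->
    x \in A_ n -> x \in I -> x \notin J ->
  (hilbert_series A_ J n < hilbert_series A_ I n)%N.
Proof.
move=> sJI xA xI; have [M IM] := ideal_rowspace I n.
have [N JN] := ideal_rowspace J n.
rewrite (hilbert_series_rank IM) (hilbert_series_rank JN) => /negP xJ.
apply: rank_ltmx; apply/andP; split.
  by apply/row_subP => i; apply/IM/sJI/JN/row_sub.
have xE : x = gvec (gcoord n x) by rewrite gcoordK gcomp_id.
apply/negP => sMN; apply: xJ; rewrite xE; apply/JN; apply: submx_trans sMN.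
by apply/IM; rewrite -xE.
Qed.

End Coordinates.

Lemma quotmod_pi_eq0 (R : pzRingType) (V : lmodType R) (W : submodClosed V) x :
  quotmod_pi W x = 0 <-> x \in W.
Proof. by rewrite -(linear0 (quotmod_pi W)) -[in X in _ <-> X](subr0 x);
  apply: quotmod_eq. Qed.

(** * Degrees of generators and relations *)

Section GeneratedDegrees.
Variables (k : fieldType) (A : algType k) (A_ : nat -> submodClosed A).
Hypothesis gr : connected_graded A_.
Implicit Types (I J : right_ideal A) (x y : A).

Lemma one_in_grade0 : 1 \in A_ 0%N.
Proof. by apply/(grade_connected gr); exists 1; rewrite scale1r. Qed.

Lemma gcompM n x a : exists N,
  gcomp A_ n (x * a) = \sum_(u < N | (u <= n)%N) gcomp A_ (n - u) x * gcomp A_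
    u a.
Proof.
have [N aN] := gcomp_sumE gr a; exists N.
rewrite {1}(aN N (leqnn N)) mulr_sumr (gcomp_sum gr) [RHS]big_mkcond.
by apply: eq_bigr => u _; rewrite (gcompMr gr _ _ (gcomp_in gr u a)).
Qed.

(* Without the annotation, y * w would be the product of the opposite ring.   *)
Inductive low_generated I (d n : nat) : A -> Prop :=
| LowGen0 : low_generated I d n 0
| LowGenD j (y w z : A) : (j <= d)%N -> (j <= n)%N -> y \in I -> y \in A_ j ->
    w \in A_ (n - j)%N -> low_generated I d n z ->
    low_generated I d n (y * w + z).

Lemma low_generatedD I d n z z' :
  low_generated I d n z -> low_generated I d n z' -> low_generated I d n (z +
    z').
Proof.
move=> Gz Gz'; elim: Gz => [|j y w {}z le_jd le_jn yI yA wA _ IH].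
  by rewrite add0r.
by rewrite -addrA; apply: (LowGenD le_jd le_jn).
Qed.

Lemma low_generated_sum I d n (J : Type) (r : seq J) (P : pred J) (F : J -> A) :
  (forall i, P i -> low_generated I d n (F i)) ->
  low_generated I d n (\sum_(i <- r | P i) F i).
Proof.
move=> FG; elim/big_ind: _ => //; [exact: LowGen0 | exact: low_generatedD].
Qed.

Lemma low_generatedM I d n m (z b : A) : b \in A_ m ->
  low_generated I d n z -> low_generated I d (n + m) (z * b).
Proof.
move=> bA; elim=> [|j y w {}z le_jd le_jn yI yA wA _ IH].
  by rewrite mul0r; apply: LowGen0.
rewrite mulrDl -mulrA; apply: (LowGenD le_jd _ yI yA _ IH).
  exact: leq_trans le_jn (leq_addr _ _).
by rewrite -addnBAC //; apply: (grade_mul gr).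
Qed.

Lemma low_degree_generated I d n y :
  (n <= d)%N -> y \in I -> y \in A_ n -> low_generated I d n y.
Proof.
move=> le_nd yI yA; rewrite -[y]mulr1 -[y * 1]addr0.
apply: (LowGenD le_nd _ yI yA _ (LowGen0 _ _ _)) => //.
by rewrite subnn one_in_grade0.
Qed.

Lemma aug_mul_gen I x (a : A) j :
  x \in I -> a \in A_ j -> (0 < j)%N -> x * a \in aug_mul A_ I.
Proof. by move=> xI aA j0; apply: mem_gen_submod; exists x, a, j. Qed.

(** Beyond the degrees occurring in a finite generating set, every homogeneous element of [I] is a
    combination with coefficients of positive degree. *)
Lemma aug_mul_bound I : homogeneous A_ I -> finitely_generated I ->
  exists N, forall n (y : A), (N <= n)%N -> y \in I -> y \in A_ n -> y \in
    aug_mul A_ I.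
Proof.
move=> Ih [s Is].
have [N sN] : exists N, forall x n, x \in s -> (N <= n)%N -> gcomp A_ n x = 0.
  elim: s {Is} => [|x s [N sN]]; first by exists 0%N.
  have [N' [_ x0 _]] := gcomp_decomp gr x.
  exists (maxn N N') => z n;
    rewrite inE geq_max => /orP[/eqP->|zs] /andP[le le'].
    exact: x0.
  exact: sN.
exists N => n y le_Nn yI yA; rewrite -(gcomp_id gr yA).
(* Membership in [I] is carried along because low components of [z], times coefficients of positive
   degree, also contribute to high degrees. *)
pose Q (z : A) := z \in I /\ forall n, (N <= n)%N -> gcomp A_ n z \in aug_mul
  A_ I.
suff [_ /(_ n le_Nn)//] : Q y.
have : y \in gen_submod (V := (A^c)^o) [set x | x \in s] by rewrite -Is.
move: y {yI yA}; apply: (@gen_submod_ind _ (A^c)^o _ Q) => [|a x y [xI xN] [yI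
  yN]|x /= xs]; rewrite /Q.
- split; first exact: rideal0.
  by move=> m _; rewrite (gcomp0 gr); apply: rideal0.
- split=> [|m le_Nm]; first by apply: ridealD => //; apply: right_idealM.
  rewrite (gcompD gr); apply: ridealD; last exact: yN.
  have [M ->] := gcompM m x a; apply: rideal_sum => u le_um.
  case: (posnP u) => [u0|u_gt0].
    rewrite u0 subn0; have /(grade_connected gr)[c ->] := gcomp_in gr 0 a.
    by rewrite -scalerAr mulr1; apply/ridealZ/xN.
  exact: aug_mul_gen (homogeneous_gcomp gr _ Ih xI) (gcomp_in gr _ _) u_gt0.
split=> [|m le_Nm]; first by rewrite Is; apply: mem_gen_submod.
by rewrite (sN _ _ xs) //; apply: rideal0.
Qed.

Lemma aug_mul_tor0 I n y :
  tor0 A_ I n = [set 0] -> y \in I -> y \in A_ n -> y \in aug_mul A_ I.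
Proof.
move=> tor yI yA.
have : tor0 A_ I n (quotmod_pi (aug_mul A_ I) y) by exists y.
by rewrite tor => /quotmod_pi_eq0.
Qed.

(** By [aug_mul_bound] the degrees with nonzero Tor are bounded, so the supremum [m0] really is an
    upper bound for them. *)
Lemma m0_aug_mul I n y : homogeneous A_ I -> finitely_generated I ->
  (m0 A_ I < n)%N -> y \in I -> y \in A_ n -> y \in aug_mul A_ I.
Proof.
move=> Ih Ifg lt_n; apply: aug_mul_tor0; apply: contrapT => torn.
move: lt_n; rewrite ltnNge; apply/negP/negPn.
apply: (@ge_supremum_Nmem _ _ 0%N [set j | tor0 A_ I j <> [set 0]]) => //.
apply: nat_supremums_neq0.
have [N IN] := aug_mul_bound Ih Ifg; exists N => m /= torm.
rewrite Order.NatOrder.leEnat leqNgt; apply/negP => lt_Nm; apply: torm.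
apply/seteqP; split=> [_ [x [xI xA] <-]|_ ->] /=; last first.
  exists 0; last exact: linear0.
  by split; [apply: rideal0 | apply: rpred0].
by apply/quotmod_pi_eq0; apply: (IN m) => //; apply: ltnW.
Qed.

(** Graded Nakayama lemma: above degree [d] an element of [I] lies in I A_+, hence is a combination
    of elements of [I] of smaller degree. *)
Lemma m0_low_generated I d n y : homogeneous A_ I -> finitely_generated I ->
  (m0 A_ I <= d)%N -> y \in I -> y \in A_ n -> low_generated I d n y.
Proof.
move=> Ih Ifg le_d; elim/ltn_ind: n y => n IHn y yI yA.
have [le_nd|lt_dn] := leqP n d; first exact: low_degree_generated.
have yaug : y \in aug_mul A_ I by apply: m0_aug_mul yI yA => //;
  apply: leq_ltn_trans lt_dn.
pose Q (z : A) := forall m, (m <= n)%N -> low_generated I d m (gcomp A_ m z).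
suff /(_ n (leqnn n)) : Q y by rewrite (gcomp_id gr yA).
move: y yaug {yI yA}; apply: (@gen_submod_ind _ (A^c)^o _ Q) =>
  [|a x y Gx Gy|_ [x [a [j [xI aA j0 ->]]]]] m le_mn.
- by rewrite (gcomp0 gr); apply: LowGen0.
- rewrite (gcompD gr); apply: low_generatedD; last exact: Gy.
  have [M ->] := gcompM m x a; apply: low_generated_sum => u le_um.
  rewrite -{1}(subnK le_um); apply: low_generatedM; first exact: gcomp_in.
  by apply: Gx; apply: leq_trans le_mn; apply: leq_subr.
rewrite (gcompMr gr _ _ aA); case: ifP => [le_jm|_]; last exact: LowGen0.
rewrite -{1}(subnK le_jm); apply: low_generatedM => //; apply: IHn.
- by apply: leq_trans le_mn; rewrite ltn_subrL j0 (leq_trans j0).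
- exact: homogeneous_gcomp.
exact: gcomp_in.
Qed.

(** Take for [x] a homogeneous lift of the image of 1, so that the isomorphism is a |-> x a.
    Injectivity identifies [J2], and surjectivity gives I = x A + J1. *)
Lemma shift_generator I J1 J2 t : shift_isomorphic A_ I J1 J2 t ->
  exists x, [/\ x \in A_ t, x \in I, forall a, x * a \in J1 <-> a \in J2 &
    forall y : A, y \in I -> exists a, y - x * a \in J1].
Proof.
move=> [f [f_inj f_range f_deg]].
have : quot_component A_ I J1 t (f (quotmod_pi J2 1)).
  rewrite -f_deg; exists (quotmod_pi J2 1) => //.
  rewrite /shift_quot_component leqnn subnn; exists 1 => //.
  by split=> //; apply: one_in_grade0.
move=> [x [xI xA] fx].
have fE (a : A) : f (quotmod_pi J2 a) = quotmod_pi J1 (x * a).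
  transitivity (f ((a : A^c) *: quotmod_pi J2 1)).
    by rewrite -linearZ; congr (f (quotmod_pi _ _)); rewrite /= -[LHS]mul1r.
  by rewrite linearZ /= -fx -linearZ.
exists x; split=> // [a|y yI].
  rewrite -!quotmod_pi_eq0 -fE; split=> [|->]; last exact: linear0.
  by rewrite -(linear0 f) => /f_inj.
have : range f (quotmod_pi J1 y) by rewrite f_range; exists y.
move=> [q _]; elim/quotW: q => a fa; exists a.
have piB : quotmod_pi J1 (y - x * a) = quotmod_pi J1 y - quotmod_pi J1 (x * a).
  exact: linearB.
by apply/quotmod_pi_eq0; rewrite piB -fE -fa subrr.
Qed.

Lemma homogeneous_sub I J :
    homogeneous A_ I -> (forall n (x : A), x \in I -> x \in A_ n -> x \in J) ->
  {subset I <= J}.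
Proof.
move=> Ih IJ x xI; have [N xN] := gcomp_sumE gr x; rewrite (xN N (leqnn N)).
apply: rideal_sum => i _; apply: (IJ i); last exact: gcomp_in.
exact: homogeneous_gcomp.
Qed.

End GeneratedDegrees.

(** * Relations between generators *)

Definition fcons (T : Type) s (a0 : T) (a : 'I_s -> T) (i : 'I_s.+1) : T :=
  if unlift ord0 i is Some j then a j else a0.

Lemma fcons0 (T : Type) s (a0 : T) (a : 'I_s -> T) : fcons a0 a ord0 = a0.
Proof. by rewrite /fcons unlift_none. Qed.

Lemma fconsS (T : Type) s (a0 : T) (a : 'I_s -> T) i :
  fcons a0 a (lift ord0 i) = a i.
Proof. by rewrite /fcons liftK. Qed.

Lemma forall_fcons s (Q : 'I_s.+1 -> Prop) :
  Q ord0 -> (forall i : 'I_s, Q (lift ord0 i)) -> forall i, Q i.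
Proof. by move=> Q0 QS i; case: (unliftP ord0 i) => [j|] ->. Qed.

Lemma sum_fcons (R : pzRingType) s (x0 : R) (x : 'I_s -> R) a :
  \sum_i fcons x0 x i * a i = x0 * a ord0 + \sum_i x i * a (lift ord0 i).
Proof. by rewrite big_ord_recl fcons0; under eq_bigr do rewrite fconsS. Qed.

Section Relations.
Variables (k : fieldType) (A : algType k) (A_ : nat -> submodClosed A).
Hypothesis gr : connected_graded A_.

(** Homogeneous syzygies of degree [n]. The case n < t_i is separate because truncated subtraction
    would place the coefficient in degree 0. *)
Definition relation s (t : 'I_s -> nat) (x : 'I_s -> A) (n : nat)
    (a : 'I_s -> A) : Prop :=
  (forall i, if (t i <= n)%N then (a i \in A_ (n - t i)%N : Prop)
             else a i = 0) /\
  \sum_i x i * a i = 0.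

Inductive generated_relation s (t : 'I_s -> nat) (x : 'I_s -> A) (d n : nat) :
    ('I_s -> A) -> Prop :=
| GenRel0 : generated_relation t x d n (fun=> 0)
| GenRelD m r b a : (m <= d)%N -> (m <= n)%N -> relation t x m r ->
    b \in A_ (n - m)%N -> generated_relation t x d n a ->
    generated_relation t x d n (fun i => r i * b + a i).

Lemma generated_relationP s (t : 'I_s -> nat) x d n a :
  generated_relation t x d n a -> relation t x n a.
Proof.
elim=> [|m r b {}a _ le_mn [rA r0] bA _ [aA a0]].
  split=> [i|]; first by case: ifP => _; rewrite ?rpred0.
  by rewrite big1 // => i _; rewrite mulr0.
split=> [i|]; last first.
  under eq_bigr do rewrite mulrDr mulrA.
  by rewrite big_split /= -mulr_suml r0 a0 mul0r addr0.
move: (rA i) (aA i); case: leqP => [le_tm|lt_mt].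
  rewrite (leq_trans le_tm le_mn) => riA aiA; rewrite rpredD //.
  have -> : (n - t i = (m - t i) + (n - m))%N by rewrite addnBAC // subnKC.
  exact: (grade_mul gr).
by move=> ->; rewrite mul0r add0r.
Qed.

Lemma generated_relationD s (t : 'I_s -> nat) x d n a a' :
  generated_relation t x d n a -> generated_relation t x d n a' ->
  generated_relation t x d n (fun i => a i + a' i).
Proof.
move=> Ga Ga'; elim: Ga => [|m r b {}a le_md le_mn rR bA _ IH].
  by have -> : (fun i => 0 + a' i) = a' by apply/funext => i; rewrite add0r.
have -> : (fun i => r i * b + a i + a' i) = (fun i => r i * b + (a i + a' i)).
  by apply/funext => i; rewrite addrA.
exact: (GenRelD le_md le_mn).
Qed.

Lemma relation_fcons0 s t0 (t : 'I_s -> nat) x0 x n a :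
  relation t x n a -> relation (fcons t0 t) (fcons x0 x) n (fcons 0 a).
Proof.
move=> [aA a0]; split.
  apply: forall_fcons => [|i]; rewrite ?fcons0 ?fconsS; last exact: aA.
  by case: ifP => _; rewrite ?rpred0.
rewrite sum_fcons fcons0 mulr0 add0r.
by under eq_bigr do rewrite fconsS.
Qed.

Lemma generated_relation_fcons0 s t0 (t : 'I_s -> nat) x0 x d n a :
  generated_relation t x d n a ->
  generated_relation (fcons t0 t) (fcons x0 x) d n (fcons 0 a).
Proof.
elim=> [|m r b {}a le_md le_mn rR bA _ IH].
  have -> : fcons 0 (fun=> 0) = (fun=> 0) :> ('I_s.+1 -> A).
    by apply/funext; apply: forall_fcons => [|i]; rewrite ?fcons0 ?fconsS.
  exact: GenRel0.
have -> : fcons 0 (fun i => r i * b + a i) =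
    fun i => fcons 0 r i * b + fcons 0 a i.
  apply/funext; apply: forall_fcons => [|i]; rewrite ?fcons0 ?fconsS //.
  by rewrite mul0r addr0.
by apply: (GenRelD le_md le_mn) => //; apply: relation_fcons0.
Qed.

Definition presentation (d e : nat) (I : right_ideal A) s (t : 'I_s -> nat)
    (x : 'I_s -> A) : Prop :=
  [/\ forall i, (t i <= d)%N, forall i, x i \in A_ (t i),
      forall y : A, y \in I <-> exists a, y = \sum_i x i * a i &
      forall n a, (e < n)%N -> relation t x n a ->
        generated_relation t x e n a].

(** In a relation x0 a0 + sum x_i a_i = 0 the coefficient a0 lies in [J2], hence is a sum of
    products y w with y in [J2] of degree at most [d]. Each y extends to a relation, since x0 y is
    in [J1], of degree t0 + deg y <= 2d. Subtracting multiples of these leaves a relation of [J1]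
    alone. *)
Lemma presentation_step d (I J1 J2 : right_ideal A) t0 (x0 : A) s
    (t : 'I_s -> nat) x :
    presentation d (d + d) J1 t x ->
    (t0 <= d)%N -> x0 \in A_ t0 -> x0 \in I -> {subset J1 <= I} ->
    (forall a : A, x0 * a \in J1 <-> a \in J2) ->
    (forall y : A, y \in I -> exists a, y - x0 * a \in J1) ->
    (forall n (y : A), y \in J2 -> y \in A_ n -> low_generated A_ J2 d n y) ->
  presentation d (d + d) I (fcons t0 t) (fcons x0 x).
Proof.
move=> [td xA Jx rx] t0d x0A x0I sJI x0J Ix0 J2low; split.
- by apply: forall_fcons => [|i]; rewrite ?fcons0 ?fconsS.
- by apply: forall_fcons => [|i]; rewrite ?fcons0 ?fconsS.
- move=> y; split=> [/Ix0[a0 /Jx[a ya]]|[a ->]].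
    exists (fcons a0 a); rewrite sum_fcons fcons0.
    by under eq_bigr do rewrite fconsS; rewrite -ya addrC subrK.
  rewrite sum_fcons; apply: ridealD; first exact: right_idealM.
  by apply/sJI/Jx; exists (a \o lift ord0).
move=> n a lt_n aR.
have t0n : (t0 <= n)%N by apply: leq_trans (ltnW lt_n);
  apply: leq_trans (leq_addr _ _).
have [aA a0] := aR.
have a0A : a ord0 \in A_ (n - t0)%N by have := aA ord0; rewrite fcons0 t0n.
have a0J2 : a ord0 \in J2.
  apply/x0J; move: a0; rewrite sum_fcons => /eqP.
  rewrite addr_eq0 => /eqP->; apply: ridealN; apply/Jx.
  by exists (a \o lift ord0).
have lift_low m z : low_generated A_ J2 d m z -> exists b,
    generated_relation (fcons t0 t) (fcons x0 x) (d + d) (t0 + m) (fcons z b).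
  elim=> [|j y w {}z le_jd le_jm yJ yA wA _ [b Gb]].
    exists (fun=> 0); have -> : fcons 0 (fun=> 0) = (fun=> 0) :> ('I_s.+1 -> A).
      by apply/funext; apply: forall_fcons => [|i]; rewrite ?fcons0 ?fconsS.
    exact: GenRel0.
  have /Jx[c yc] : x0 * y \in J1 by apply/x0J.
  (* The coefficients [c] of x0 y need not be homogeneous; only the parts contributing to degree t0
     + j are kept. *)
  pose r i := if (t i <= t0 + j)%N then - gcomp A_ (t0 + j - t i) (c i) else 0.
  exists (fun i => r i * w + b i).
  have -> : fcons (y * w + z) (fun i => r i * w + b i) =
      fun i => fcons y r i * w + fcons z b i.
    by apply/funext; apply: forall_fcons => [|i]; rewrite ?fcons0 ?fconsS.
  apply: (@GenRelD _ _ _ _ _ (t0 + j)) => //.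
  - exact: leq_add.
  - by rewrite leq_add2l.
  - split.
      apply: forall_fcons => [|i]; rewrite ?fcons0 ?fconsS.
        by rewrite leq_addr addKn.
      rewrite /r; case: leqP => // _; rewrite -sub0r.
      by apply: submod_rpredB; [apply: rpred0 | apply: gcomp_in].
    rewrite sum_fcons fcons0; under eq_bigr do rewrite fconsS.
    have x0yA : x0 * y \in A_ (t0 + j)%N by apply: (grade_mul gr).
    rewrite -(gcomp_id gr x0yA) yc (gcomp_sum gr) -big_split big1 //= => i _.
    by rewrite (gcompMl gr _ _ (xA i)) /r; case: ifP => _;
      rewrite ?mulrN ?mulr0 ?addrN ?addr0.
  by rewrite subnDl.
have [b] := lift_low _ _ (J2low _ _ a0J2 a0A); rewrite subnKC // => Gb.
have [bA b0] := generated_relationP Gb.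
pose c i := a (lift ord0 i) - b i.
have aE : a = fun i => fcons (a ord0) b i + fcons 0 c i.
  apply/funext; apply: forall_fcons => [|i]; rewrite ?fcons0 ?fconsS ?addr0 //.
  by rewrite addrC subrK.
rewrite aE; apply: generated_relationD => //.
apply/generated_relation_fcons0/rx => //; split=> [i|].
  move: (aA (lift ord0 i)) (bA (lift ord0 i)); rewrite !fconsS /c.
  by case: ifP => _ => [|-> ->]; [apply: submod_rpredB | rewrite subrr].
under eq_bigr do rewrite mulrBr; rewrite sumrB.
apply/eqP; rewrite subr_eq0; apply/eqP.
move: b0; rewrite -[RHS]a0 !sum_fcons fcons0 => /addrI.
by under eq_bigr do rewrite fconsS; move->.
Qed.

End Relations.

(** * Descending chains in the family *)

Section Chains.
Variables (k : fieldType) (A : algType k) (A_ : nat -> submodClosed A).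
Variables (F : set (right_ideal A)) (d : nat).
Hypotheses (gr : connected_graded A_) (fp : finitely_presented A).
Hypotheses (qcF : quasi_coherent_family A_ F) (Fd : of_degree A_ F d).

Lemma family_low_generated I n (y : A) :
  F I -> y \in I -> y \in A_ n -> low_generated A_ I d n y.
Proof.
by move=> FI; have [Ifg Ih] := qc_ideals qcF FI; apply: m0_low_generated; auto.
Qed.

(** If t > d, then modulo x A nothing changes in degrees at most [d], so [J1] would contain the
    generators of [I]. Likewise x in [J1] would give I = J1. *)
Lemma family_step I : F I -> (exists2 y : A, y \in I & y != 0) ->
  exists J1 J2 t x, [/\ F J1, F J2, {subset J1 <= I} & (t <= d)%N] /\
    [/\ x \in A_ t, x \in I, x \notin J1,
        forall a, x * a \in J1 <-> a \in J2 &
        forall y : A, y \in I -> exists a, y - x * a \in J1].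
Proof.
move=> FI nzI; have [J1 [J2 [FJ1 [FJ2 []]]]] := qc_step qcF FI nzI.
move=> sJI nsIJ _ [t /(shift_generator gr)[x [xA xI xJ Ix]]].
have [_ J1h] := qc_ideals qcF FJ1; have [_ Ih] := qc_ideals qcF FI.
exists J1, J2, t, x; split; split=> //.
  rewrite leqNgt; apply/negP => lt_dt; apply: nsIJ.
  apply: (homogeneous_sub gr Ih) => n y yI yA.
  elim: {yI yA}(family_low_generated FI yI yA) => [|j z w {}y le_jd _ zI zA _ _
    yJ].
    exact: rideal0.
  apply: ridealD => //; apply: right_idealM; have [a] := Ix z zI.
  move=> /(homogeneous_gcomp gr j J1h).
  rewrite (gcompB gr) (gcomp_id gr zA) (gcompMl gr _ _ xA).
  by rewrite leqNgt (leq_ltn_trans le_jd lt_dt) subr0.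
apply/negP => xJ1; apply: nsIJ => y yI; have [a yxa] := Ix y yI.
by rewrite -[y](subrK (x * a)); apply: ridealD => //; apply: right_idealM.
Qed.

(** Induction on the total dimension of [I] in degrees at most [d]. It drops strictly from [I] to
    [J1], since the new generator has degree at most [d] and is not in [J1]. *)
Lemma presentation_exists N I :
    F I -> (\sum_(j < d.+1) hilbert_series A_ I j < N)%N ->
  exists s (t : 'I_s -> nat) (x : 'I_s -> A),
    (s < N)%N /\ presentation A_ d (d + d) I t x.
Proof.
have [D [e eP]] := grade_basis gr fp.
elim: N I => // N IHN I FI le_IN.
have [nzI|I0] := pselect (exists2 y : A, y \in I & y != 0); last first.
  exists 0%N, (fun=> 0%N), (fun=> 0); split=> //; split=> [[]|[]|y|n a _ _] //.
    split=> [yI|[a ->]]; last by rewrite big_ord0; apply: rideal0.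
    exists (fun=> 0); rewrite big_ord0; apply/eqP; apply: contrapT => /negP nz.
    by apply: I0; exists y.
  by have -> : a = (fun=> 0); [apply/funext; case | apply: GenRel0].
have [J1 [J2 [t0 [x0 [[FJ1 FJ2 sJI le_t0d] [x0A x0I x0J x0J2 Ix0]]]]]] :=
  family_step FI nzI.
have lt_JI : (\sum_(j < d.+1) hilbert_series A_ J1 j <
    \sum_(j < d.+1) hilbert_series A_ I j)%N.
  rewrite -ltnS in le_t0d; rewrite (bigD1 (Ordinal le_t0d)) //=.
  rewrite [X in (_ < X)%N](bigD1 (Ordinal le_t0d)) //= -addSn leq_add //.
    exact: hilbert_series_lt x0A x0I x0J.
  by apply: leq_sum => i _; apply: hilbert_series_le.
have [s [t [x [lt_sN J1p]]]] := IHN J1 FJ1 (leq_trans lt_JI le_IN).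
exists s.+1, (fcons t0 t), (fcons x0 x); split=> //.
apply: presentation_step J1p _ _ _ _ x0J2 _ _ => // n y yJ yA.
exact: family_low_generated.
Qed.

End Chains.

(** * Presentations as matrices *)

Section PresentationMatrices.
Variables (k : fieldType) (A : algType k) (A_ : nat -> submodClosed A).
Variables (D : nat -> nat) (e : forall n, 'I_(D n) -> A).
Hypothesis gr : connected_graded A_.
Hypothesis eP : forall n,
  [/\ forall i, @e n i \in A_ n,
      forall a, a \in A_ n -> exists c : 'rV_(D n), a = \sum_i c 0 i *: e i &
      forall c : 'rV_(D n), \sum_i c 0 i *: e i = 0 -> c = 0].

Variables (s : nat) (t : 'I_s -> nat).

Local Notation coord := (gcoord A_ e).
Local Notation vec := (gvec e).
Local Notation free_dim n := (\sum_i D (n - t i))%N.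

(* The degree n component of the graded free module with generators in        *)
(* degrees t i. Where n < t i, the truncated subtraction gives a superfluous  *)
(* coordinate of degree 0, on which free_elt vanishes.                        *)
Definition free_coord n (a : 'I_s -> A) : 'rV[k]_(free_dim n) :=
  \mxrow_i coord (n - t i) (a i).

Definition free_elt n (u : 'rV[k]_(free_dim n)) (i : 'I_s) : A :=
  if (t i <= n)%N then vec (submxrow u i) else 0.

Definition free_hom n (a : 'I_s -> A) : Prop :=
  forall i, if (t i <= n)%N then (a i \in A_ (n - t i)%N : Prop) else a i = 0.

Lemma free_elt_hom n u : free_hom n (free_elt (n := n) u).
Proof. by move=> i; rewrite /free_elt; case: leqP => // _;
  apply: (gvec_in eP). Qed.

Lemma free_coordK n a : free_hom n a -> free_elt (free_coord n a) = a.
Proof.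
move=> aA; apply/funext => i; rewrite /free_elt /free_coord mxrowK.
by have := aA i; case: leqP => [_ /(gcomp_id gr) aE|_ ->] //;
  rewrite (gcoordK gr eP).
Qed.

Lemma free_eltK n u : (forall i, t i <= n)%N ->
  free_coord n (free_elt (n := n) u) = u.
Proof.
move=> tn; rewrite -[RHS]submxrowK; apply: eq_mxrow => i.
by rewrite /free_elt tn (gvecK gr eP).
Qed.

Lemma free_elt_linear n c u v i :
  free_elt (n := n) (c *: u + v) i = c *: free_elt u i + free_elt v i.
Proof.
rewrite /free_elt; case: ifP => _; last by rewrite scaler0 addr0.
by rewrite -linearP; congr (vec _); apply/rowP => j; rewrite !mxE.
Qed.

Lemma free_coord_linear n c a b :
  free_coord n (fun i => c *: a i + b i) = c *: free_coord n a + free_coord n b.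
Proof. by apply/rowP => j; rewrite !mxE (gcoord_linear gr eP) // !mxE. Qed.

Lemma free_coord0 n : free_coord n (fun=> 0) = 0.
Proof. by apply/rowP => j; rewrite !mxE (gcoord0 gr eP) // mxE. Qed.

Definition eval_free (x a : 'I_s -> A) : A := \sum_i x i * a i.

Lemma eval_free_in n x a : (forall i, x i \in A_ (t i)) -> free_hom n a ->
  eval_free x a \in A_ n.
Proof.
move=> xA aA; apply: rpred_sum => i _; have := aA i.
case: leqP => [le_tn|_ ->]; last by rewrite mulr0 rpred0.
by move=> aiA; rewrite -[X in A_ X](subnKC le_tn); apply: (grade_mul gr).
Qed.

Definition eval_mx n (x : 'I_s -> A) : 'M[k]_(free_dim n, D n) :=
  \mxcol_i \matrix_(b, c)
    (if (t i <= n)%N then coord n (x i * @e (n - t i)%N b) 0 c else 0).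

Lemma mul_eval_mx n x u :
  u *m eval_mx n x = coord n (eval_free x (free_elt u)).
Proof.
rewrite -{1}[u]submxrowK mul_mxrow_mxcol (gcoord_sum gr eP) //;
  apply: eq_bigr => i _.
rewrite /free_elt; case: leqP => le_tn; last first.
  rewrite mulr0 (gcoord0 gr eP) //; apply/rowP => c;
    rewrite !mxE big1 // => b _.
  by rewrite !mxE mulr0.
rewrite mulr_sumr (gcoord_sum gr eP) //; apply/rowP => c; rewrite mxE summxE.
by apply: eq_bigr => b _; rewrite -scalerAr (gcoordZ gr eP) // !mxE.
Qed.

Definition act_mx m n (b : A) : 'M[k]_(free_dim m, free_dim n) :=
  lin1_mx (fun u => free_coord n (fun i => free_elt u i * b)).

Lemma mul_act_mx m n b u :
  u *m act_mx m n b = free_coord n (fun i => free_elt u i * b).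
Proof.
pose f (u : 'rV_(free_dim m)) := free_coord n (fun i => free_elt u i * b).
have f_lin : linear f.
  move=> c v w; rewrite -free_coord_linear; congr free_coord; apply/funext => i.
  by rewrite free_elt_linear mulrDl scalerAl.
pose fL : {linear 'rV[k]_(free_dim m) -> 'rV[k]_(free_dim n)} :=
  HB.pack f (GRing.isLinear.Build _ _ _ _ f f_lin).
exact: (mul_rV_lin1 fL).
Qed.

Section Presentation.
Variables (d d' : nat) (I : right_ideal A) (x : 'I_s -> A).
Hypotheses (le_dd' : (d <= d')%N) (Ip : presentation A_ d d' I t x).

Lemma presentation_hilbert_series n :
  hilbert_series A_ I n = \rank (eval_mx n x).
Proof.
have [_ xA Ix _] := Ip; apply: (hilbert_series_rank gr eP) => v; split.
  move=> /Ix[a va].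
  (* In degree n only these components of the coefficients matter. *)
  pose a' i := if (t i <= n)%N then gcomp A_ (n - t i) (a i) else 0.
  have a'A : free_hom n a'.
    by move=> i; rewrite /a'; case: leqP => // _; apply: gcomp_in.
  have va' : vec v = eval_free x a'.
    rewrite -(gcomp_id gr (gvec_in eP v)) va gcomp_sum //;
      apply: eq_bigr => i _.
    by rewrite (gcompMl gr _ _ (xA i)) /a'; case: ifP; rewrite ?mulr0.
  rewrite -(gvecK gr eP v) va' -(free_coordK a'A) -mul_eval_mx.
  exact: submxMl.
move=> /submxP[u ->]; rewrite mul_eval_mx (gcoordK gr eP) //.
rewrite (gcomp_id gr) ?eval_free_in //; last exact: free_elt_hom.
by apply/Ix; exists (free_elt u).
Qed.

(** The kernel in degree n consists of the relations of degree n, which are sums of relations of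
    degrees m <= d' times elements of A_(n-m). By linearity basis elements of A_(n-m) suffice. *)
Lemma presentation_kernel n : (d' < n)%N ->
  (kermx (eval_mx n x) :=:
   \sum_(j : {m : 'I_d'.+1 & 'I_(D (n - m))})
     <<kermx (eval_mx (tag j) x) *m act_mx (tag j) n (e (tagged j))>>)%MS.
Proof.
have [td xA _ rx] := Ip; move=> lt_d'n.
have tn i : (t i <= n)%N by rewrite (leq_trans (td i)) // (leq_trans le_dd') //
  ltnW.
apply/eqmxP/andP; split; last first.
  apply/sumsmx_subP => j _; rewrite genmxE; apply/sub_kermxP/row_matrixP => i.
  rewrite row0 2!row_mul -mulmxA; set u := row i _.
  have : u *m eval_mx (tag j) x = 0 by rewrite -row_mul mulmx_ker row0.
  rewrite mulmxA mul_act_mx !mul_eval_mx => u0.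
  have lt_j : (tag j < n)%N by rewrite (leq_trans _ lt_d'n) // ltn_ord.
  have euA := eval_free_in xA (free_elt_hom u).
  rewrite free_coordK; last first.
    move=> l; rewrite tn; have := free_elt_hom u l.
    case: leqP => [le_tj uA|_ ->]; last by rewrite mul0r rpred0.
    have -> : (n - t l = (tag j - t l) + (n - tag j))%N.
      by rewrite addnBAC // subnKC // ltnW.
    by apply: (grade_mul gr) => //; have [] := eP (n - tag j).
  have -> : eval_free x (fun l => free_elt u l * e (tagged j)) =
      eval_free x (free_elt u) * e (tagged j).
    by rewrite mulr_suml; apply: eq_bigr => l _; rewrite mulrA.
  by rewrite -(gcomp_id gr euA) -(gcoordK gr eP) // u0 linear0 mul0r (gcoord0
    gr eP).
apply/row_subP => i; set v := row i _.
have v0 : v *m eval_mx n x = 0 by rewrite -row_mul mulmx_ker row0.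
have /rx : relation A_ t x n (free_elt v).
  split; first exact: free_elt_hom.
  rewrite -/(eval_free _ _) -(gcomp_id gr (eval_free_in xA (free_elt_hom v))).
  by rewrite -(gcoordK gr eP) // -mul_eval_mx v0 linear0.
move=> /(_ lt_d'n); rewrite -[X in (X <= _)%MS](free_eltK v tn).
elim=> [|m r b a le_md' le_mn [rA r0] bA _ IH];
  first by rewrite free_coord0 sub0mx.
have -> : free_coord n (fun l => r l * b + a l) =
    free_coord n (fun l => r l * b) + free_coord n a.
  rewrite -[X in X + _]scale1r -free_coord_linear; congr free_coord.
  by apply/funext => l; rewrite scale1r.
apply: addmx_sub => //.
have [_ /(_ b bA)[c ->] _] := eP (n - m).
have -> : free_coord n (fun l => r l * (\sum_b' c 0 b' *: e b')) =
    \sum_b' c 0 b' *: free_coord n (fun l => r l * e b').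
  apply/rowP => j; rewrite !mxE summxE mulr_sumr (gcoord_sum gr eP) // summxE.
  by apply: eq_bigr => b' _; rewrite -scalerAr (gcoordZ gr eP) // !mxE.
apply: summx_sub => b' _; apply: scalemx_sub.
have lt_m : (m < d'.+1)%N by [].
pose j : {m : 'I_d'.+1 & 'I_(D (n - m))} :=
  Tagged (fun m : 'I_d'.+1 => 'I_(D (n - m))) (i := Ordinal lt_m) b'.
apply: (sumsmx_sup j) => //; rewrite genmxE -{1}(free_coordK rA) -mul_act_mx.
apply: submxMr; apply/sub_kermxP.
by rewrite mul_eval_mx (free_coordK rA) /eval_free r0 (gcoord0 gr eP).
Qed.

End Presentation.

Lemma presented_finite_hilbert_series_eta d d' (eta : nat -> nat) :
    (d <= d')%N ->
  finite_set [set hilbert_series A_ I | I in [set I | exists2 x,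
    presentation A_ d d' I t x &
    forall m, (m <= d')%N -> \rank (eval_mx m x) = eta m]].
Proof.
move=> le_dd'.
have [S [ev [C [X [Sn evC evX]]]]] :=
  polynomial_functions k {i : 'I_s & 'I_(D (t i))}.
pose pt (x : 'I_s -> A) (j : {i : 'I_s & 'I_(D (t i))}) : k :=
  coord (t (tag j)) (x (tag j)) 0 (tagged j).
(* The generic [eval_mx], with the coordinates of the x_i as indeterminates. It specialises to
   [eval_mx n x] when each x_i is homogeneous of degree t_i, as on [P]. *)
pose M n : 'M[S]_(free_dim n, D n) := \mxcol_i \matrix_(b, c)
  (if (t i <= n)%N then \sum_l X (Tagged (fun i => 'I_(D (t i))) l) *
     C (coord n (@e (t i) l * @e (n - t i)%N b) 0 c) else 0).
pose P := [set x | (exists I, presentation A_ d d' I t x) /\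
  forall m, (m <= d')%N -> \rank (eval_mx m x) = eta m].
have evM x n : P x -> map_mx (ev (pt x)) (M n) = eval_mx n x.
  move=> [[I [_ xA _ _]] _]; apply/matrixP => i c; rewrite !mxE.
  case: ifP => _; last exact: rmorph0.
  rewrite rmorph_sum -(gcomp_id gr (xA _)) -(gcoordK gr eP) // mulr_suml
    (gcoord_sum gr eP) //.
  rewrite summxE; apply: eq_bigr => l _.
  by rewrite rmorphM evC evX -scalerAl (gcoordZ gr eP) // mxE.
have fin : finite_set ((fun x n => \rank (map_mx (ev (pt x)) (M n))) @` P).
  apply: (@finite_locally_constant _ _ _ _ (fun x => ev (pt x))) => // x0 n Px0.
  apply: (@rank_locally_constant _ _ _ (fun x => ev (pt x)) C _
    (fun n => free_dim n) D d' M eta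
    (fun n => {m : 'I_d'.+1 & 'I_(D (n - m))}) (fun n j => tag j : nat)
    (fun n j => act_mx (tag j) n (e (tagged j))) P) => //.
  - by move=> m j; rewrite -ltnS ltn_ord.
  - by move=> x Px m le_m; rewrite evM //; apply: Px.2.
  move=> x Px m lt_m; rewrite evM //; have [[I Ip] _] := Px.
  apply: eqmx_trans (presentation_kernel le_dd' Ip lt_m) _.
  by apply: eqmx_sums => j _; rewrite evM.
apply: sub_finite_set fin => _ [I [x Ip xeta] <-].
have Px : P x by split; first by exists I.
exists x => //; apply/funext => n; rewrite evM //.
by rewrite (presentation_hilbert_series Ip).
Qed.

Lemma presented_finite_hilbert_series d d' : (d <= d')%N ->
  finite_set [set hilbert_series A_ I | I in
    [set I | exists x, presentation A_ d d' I t x]].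
Proof.
(* The rank in degree m is at most [D m], so a finite type holds all possible lists of ranks. *)
move=> le_dd'; pose E := {ffun 'I_d'.+1 -> 'I_(\max_(m < d'.+1) D m).+1}.
pose H (eta : E) := [set hilbert_series A_ I | I in [set I | exists2 x,
    presentation A_ d d' I t x &
    forall m, (m <= d')%N -> \rank (eval_mx m x) = eta (inord m)]].
apply: (@sub_finite_set _ _ (\bigcup_(eta in [set: E]) H eta)); last first.
  apply: bigcup_finite; first exact: finite_finset.
  by move=> eta _; apply: presented_finite_hilbert_series_eta.
move=> _ [I [x Ip] <-].
exists [ffun m : 'I_d'.+1 => inord (\rank (eval_mx m x))] => //.
exists I => //; exists x => // m le_m.
rewrite ffunE (inordK (m := m)) // inordK // ltnS.
apply: leq_trans (rank_leq_col _) _.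
have lt_m : (m < d'.+1)%N := le_m.
exact: (leq_bigmax (F := fun m : 'I_d'.+1 => D m) (Ordinal lt_m)).
Qed.

End PresentationMatrices.

Theorem proposition1p9 (k : fieldType) (A : algType k)
    (A_ : nat -> submodClosed A) (F : set (right_ideal A)) (d : nat) :
  connected_graded A_ ->
  finitely_presented A ->
  quasi_coherent_family A_ F ->
  of_degree A_ F d ->
  finite_set [set hilbert_series A_ I | I in F].
Proof.
move=> gr fp qcF Fd; have [D [e eP]] := grade_basis gr fp.
(* One more than the total dimension of [A] in degrees at most [d]: a strict upper bound for the
   number of generators of any ideal of the family. *)
pose N := (\sum_(j < d.+1) D j).+1.
pose H (s : 'I_N) (t : {ffun 'I_s -> 'I_d.+1}) := [set hilbert_series A_ I |
  I in [set I | exists x, presentation A_ d (d + d) I (fun i => t i : nat) x]].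
apply: (@sub_finite_set _ _ (\bigcup_(s in [set: 'I_N]) \bigcup_(t in setT) H s
  t)).
  move=> _ [I FI <-].
  have [|s [t [x [lt_sN Ip]]]] := @presentation_exists _ _ _ F d gr fp qcF Fd N
    I FI.
    by rewrite ltnS leq_sum // => j _; apply: hilbert_series_le_dim.
  have td i : (t i < d.+1)%N by have [/(_ i)] := Ip.
  exists (Ordinal lt_sN) => //; exists [ffun i => Ordinal (td i)] => //.
  exists I => //; exists x.
  have <- // : t = fun i => [ffun i => Ordinal (td i)] i.
  by apply/funext => i; rewrite ffunE.
apply: bigcup_finite => [|s _]; first exact: finite_finset.
apply: bigcup_finite => [|t _]; first exact: finite_finset.
by apply: (presented_finite_hilbert_series gr eP); rewrite leq_addr.
Qed.
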